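(* Assume $(H^{MFG}_1)$, $(H^{MFG}_2)$, let $C\ge\tilde C$, let $\mu\in\mathcal P_{m_0}(\tilde\Gamma_C)$ be a constrained MFG equilibrium and $u$ the associated value function. Set $\ell_i(x,t)=L_i[m^\mu(t)](x,t)$, $\ell_*(t)=L_*[m^\mu(t)](t)$, $g=G[m^\mu(T)]$. Then $u(x,T)=g(x)$ for all $x\in\mathcal G$ and, for every $(x,t)\in\mathcal G\times(0,T)$ and every $\varphi\in C^1(\mathcal G\times[0,T])$ such that $u-\varphi$ has a local maximum (resp. local minimum) at $(x,t)$, one has $-\partial_t\varphi(x,t)+H_i(x,t,D\varphi(x,t))\le0$ (resp. $\ge0$) if $x\in J_i\setminus\{O\}$, and $-\partial_t\varphi(O,t)+H_O(t,D\varphi(O,t))\le0$ (resp. $\ge0$) if $x=O$; i.e. $u$ is a viscosity solution of $-\partial_tu+H_i(x,t,Du)=0$ in $J_i\setminus\{O\}$, $-\partial_tu+H_O(t,Du)=0$ at $O$, $u(\cdot,T)=g$.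
   Context: Let $N\ge 2$, $d\ge 1$, $e_1,\dots,e_N\in\mathbb R^d$ pairwise distinct unit vectors, $J_i=\{s e_i:s\ge0\}$, $\mathcal G=\bigcup_i J_i$, $O=0$, with geodesic distance $d(x,y)=|x-y|$ if $x,y$ lie in a common $J_i$ and $|x|+|y|$ otherwise. Fix $T>0$. Controls: $A_i=\{i\}\times\mathbb R$ ($i=0,\dots,N$), $A=\bigcup A_i$, $|(i,\bar a)|=|\bar a|$; $M=\{(x,a): a\in A_i \text{ if } x\in J_i\setminus\{O\},\ a\in A \text{ if } x=O\}$; $f(x,(i,\bar a))=\bar a e_i$ ($i\ge1$), $f(O,(0,\bar a))=0$. $\Gamma_t[x]$: pairs $(y,\alpha)$, $y\in W^{1,2}([t,T];\mathcal G)$, $\alpha:[t,T]\to A$ measurable, $(y,\alpha)\in M$ a.e., $\int|\alpha|^2<\infty$, $y(s)=x+\int_t^s f(y,\alpha)d\tau$; $\Gamma[x]=\Gamma_0[x]$. $\tilde F(x)=\mathbb Re_i$ on $J_i\setminus\{O\}$, $\tilde F(O)=\bigcup_i\mathbb Re_i$; $Y_{x,0}=\{y\in W^{1,2}([0,T];\mathcal G):\dot y\in\tilde F(y)\text{ a.e.}, y(0)=x\}$; $\tilde\Gamma_C[x]=\{y\in Y_{x,0}: d(y(s),O)\le C\ \forall s,\ \|\dot y\|_2\le C\}$, $\tilde\Gamma_C=\bigcup_x\tilde\Gamma_C[x]$ (uniform topology). For $y\in\tilde\Gamma_C[x]$, $\alpha_y$ is the control with $(y,\alpha_y)\in\Gamma[x]$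 and $\alpha_y(t)=(0,0)\in A_0$ for a.e. $t$ with $y(t)=O$. $\mathcal P(X)$: Borel probability measures with narrow topology; $e_t(y)=y(t)$, $m^\mu(t)=e_t\sharp\mu$. MFG costs: for $i=1,\dots,N$, $L_i:\mathcal P(\mathcal G)\to C(\mathcal G\times[0,T])$, $L_*:\mathcal P(\mathcal G)\to C([0,T])$, $G_i:\mathcal P(\mathcal G)\to C(\mathcal G)$, $G_*:\mathcal P(\mathcal G)\to\mathbb R$ continuous (sup norms). $(H^{MFG}_1)$: $K:=\max\big(\sup_m\|L_*[m]\|_\infty,\max_i\sup_m\|L_i[m]\|_\infty,\sup_m|G_*[m]|,\max_i\sup_m\|G_i[m]\|_\infty\big)<\infty$. $(H^{MFG}_2)$: $m_0\in\mathcal P(\mathcal G)$ has compact support. $L[m](x,t)=L_i[m](x,t)$ on $J_i\setminus\{O\}$, $L[m](O,t)=\min\{L_*[m](t),\min_iL_i[m](O,t)\}$; $G[m](x)=G_i[m](x)$ on $J_i\setminus\{O\}$, $G[m](O)=\min\{G_*[m],\min_iG_i[m](O)\}$. $J^\mu(x;(y,\alpha))=\int_0^T\big(L[m^\mu(\tau)](y,\tau)+\tfrac12|\alpha|^2\big)d\tau+G[m^\mu(T)](y(T))$; $\tilde\Gamma_C^{\mu,{\rm opt}}[x]=\{y\in\tilde\Gamma_C[x]: J^\mu(x;(y,\alpha_y))=\min_{\Gamma[x]}J^\mu(x;\cdot)\}$. $\tilde C>0$ is a constant (existing by the hypotheses) such that for all $C>0$, $\mu\in\mathcal P(\tilde\Gamma_C)$,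 $x\in\mathrm{supp}(m_0)$ and minimizers $(y,\alpha)$ of $J^\mu(x;\cdot)$ over $\Gamma[x]$: $\|\alpha\|_2\le\tilde C$ and $y\in\tilde\Gamma_{\tilde C}[x]$. $\mathcal P_{m_0}(\tilde\Gamma_C)=\{\mu\in\mathcal P(\tilde\Gamma_C):e_0\sharp\mu=m_0\}$; $\mu$ is a constrained MFG equilibrium if $\mu\in\mathcal P_{m_0}(\tilde\Gamma_C)$ and $\mathrm{supp}(\mu)\subset\bigcup_{x\in\mathrm{supp}(m_0)}\tilde\Gamma_C^{\mu,{\rm opt}}[x]$. Associated value function: with $\ell_O(t)=\min\{\ell_*(t),\min_i\ell_i(O,t)\}$ and $L(x,t)=L[m^\mu(t)](x,t)$, $u(x,t)=\inf_{(y,\alpha)\in\Gamma_t[x]}\big\{\int_t^T\big(L(y(\tau),\tau)+\tfrac12|\alpha(\tau)|^2\big)d\tau+g(y(T))\big\}$ for $t<T$, $u(x,T)=g(x)$. $C^1(\mathcal G\times[0,T])$: continuous $\varphi$ on $\mathcal G\times[0,T]$ whose restriction to each $J_i\times[0,T]$, as a function of $(\bar x,t)\in\mathbb R^+\times[0,T]$ via $\bar x\mapsto\bar xe_i$, is $C^1$. $D\varphi(x,t)=D\varphi_{|J_i}(x,t)\in\mathbb R$ (derivative in $\bar x$) for $x\in J_i\setminus\{O\}$, $D\varphi(O,t)=(D\varphi_{|J_1}(O,t),\dots,D\varphi_{|J_N}(O,t))\in\mathbb R^N$. Hamiltonians: $H_i(x,t,p)=\sup_{a\in\mathbb R}\{-pa-a^2/2-\ell_i(x,t)\}=p^2/2-\ell_i(x,t)$;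 $H_i^{\downarrow}(O,t,p)=\sup_{a\ge0}\{-pa-a^2/2-\ell_i(O,t)\}$; $H_O(t,(p_1,\dots,p_N))=\max\{-\ell_O(t),\max_iH_i^{\downarrow}(O,t,p_i)\}$. *)

(* Defs.v *)
From HB Require Import structures.
From mathcomp Require Import all_boot all_order all_algebra.
From mathcomp Require Import all_classical all_reals all_analysis.
Import Order.TTheory GRing.Theory Num.Theory numFieldNormedType.Exports.

Set Implicit Arguments.
Unset Strict Implicit.
Unset Printing Implicit Defensive.

Local Open Scope classical_set_scope.
Local Open Scope ring_scope.

Definition vec (R : realType) (d : nat) := matrix R 1 d.

Definition enorm {R : realType} {d : nat} (v : vec R d) : R :=
  Num.sqrt (\sum_(k < d) (v ord0 k) ^+ 2).

Definition TG (R : realType) (d : nat) := g_sigma_algebraType (@open (vec R d)).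

Definition unif_open {R : realType} {d : nat} : set (set (R -> vec R d)) :=
  [set U | forall y, U y -> exists2 eps : R, 0 < eps &
     forall z : R -> vec R d, (forall s, ball (y s) eps (z s)) -> U z].

Definition PathM (R : realType) (d : nat) := g_sigma_algebraType (@unif_open R d).

Definition evt {R : realType} {d : nat} (t : R) : PathM R d -> TG R d :=
  fun y => y t.

Lemma measurable_evt (R : realType) (d : nat) (t : R) :
  measurable_fun setT (@evt R d t).
Proof.
apply: (@measurability _ _ _ _ setT (@evt R d t) (@open (vec R d))) => //.
move=> A [B oB <-]; apply: sub_sigma_algebra => y [_ /= Byt].
have : nbhs (y t) B by apply: open_nbhs_nbhs.
move=> /nbhs_ballP[eps eps0 hB]; exists eps => // z hz; split => //.
exact: hB.
Qed.

HB.instance Definition _ (R : realType) (d : nat) (t : R) :=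
  isMeasurableFun.Build _ _ _ _ (@evt R d t) (@measurable_evt R d t).

Definition mflow {R : realType} {d : nat} (mu : probability (PathM R d) R) (t : R)
  : probability (TG R d) R := distribution mu (@evt R d t).

Definition msupp {X : Type} {R : realType} (opens : set (set X))
  (m : set X -> \bar R) : set X :=
  [set x | forall U, opens U -> U x -> (0 < m U)%E].

Notation leb := (@lebesgue_measure _).

Section Network.
Context {R : realType} {d N : nat} (e : 'I_N -> vec R d).

Definition ray (i : 'I_N) : set (vec R d) :=
  [set x | exists2 s : R, 0 <= s & x = s *: e i].
Definition ray' (i : 'I_N) : set (vec R d) :=
  [set x | exists2 s : R, 0 < s & x = s *: e i].
Definition net : set (vec R d) := [set x | exists i, ray i x].

Definition gdist (x y : vec R d) : R :=
  if `[< exists i, ray i x /\ ray i y >] then enorm (x - y)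
  else enorm x + enorm y.

(* controls: A = A_0 u A_1 u ... u A_N ; None encodes the index 0 *)
Definition ctrl := (option 'I_N * R)%type.

Definition inM (x : vec R d) (a : ctrl) : Prop :=
  net x /\ (forall i, ray' i x -> a.1 = Some i).

Definition fdyn (a : ctrl) : vec R d :=
  match a.1 with Some i => a.2 *: e i | None => 0 end.

Definition Gam (T t : R) (x : vec R d) (y : R -> vec R d) (a : R -> ctrl) : Prop :=
  net x /\
  (forall s, t <= s <= T -> net (y s)) /\
  (forall j : option 'I_N, measurable ([set s | (a s).1 = j] `&` `[t, T]%classic)) /\
  measurable_fun `[t, T]%classic (fun s => (a s).2) /\
  (\int[leb]_(s in `[t, T]%classic) (((a s).2) ^+ 2)%:E < +oo)%E /\
  {ae leb, forall s, `[t, T]%classic s -> inM (y s) (a s)} /\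
  (forall s, t <= s <= T -> forall k : 'I_d,
     ((y s) ord0 k)%:E = ((x ord0 k)%:E + \int[leb]_(r in `[t, s]%classic) ((fdyn (a r)) ord0 k)%:E)%E).

Definition cost (Lr : vec R d -> R -> R) (g : vec R d -> R) (T t : R)
  (y : R -> vec R d) (a : R -> ctrl) : \bar R :=
  (\int[leb]_(s in `[t, T]%classic) (Lr (y s) s + ((a s).2) ^+ 2 / 2)%:E + (g (y T))%:E)%E.

Definition infcost (Lr : vec R d -> R -> R) (g : vec R d -> R) (T t : R)
  (x : vec R d) : \bar R :=
  ereal_inf [set c | exists y a, Gam T t x y a /\ c = cost Lr g T t y a].

Definition valfun (Lr : vec R d -> R -> R) (g : vec R d -> R) (T : R)
  (x : vec R d) (t : R) : R :=
  if t < T then fine (infcost Lr g T t x) else g x.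

Definition tF (x v : vec R d) : Prop :=
  (forall i, ray' i x -> exists r : R, v = r *: e i) /\
  (x = 0 -> exists i (r : R), v = r *: e i).

(* Gamma~_C[x]; paths are extended constantly outside [0,T] *)
Definition tGam (T C : R) (x : vec R d) (y : R -> vec R d) : Prop :=
  y 0 = x /\
  (forall s, s <= 0 -> y s = y 0) /\ (forall s, T <= s -> y s = y T) /\
  (forall s, 0 <= s <= T -> net (y s) /\ gdist (y s) 0 <= C) /\
  exists v : R -> vec R d,
    (forall k : 'I_d, measurable_fun `[0%R, T]%classic (fun s => v s ord0 k)) /\
    (forall s, 0 <= s <= T -> forall k : 'I_d,
       ((y s) ord0 k - (y 0) ord0 k)%:E = (\int[leb]_(r in `[0%R, s]%classic) (v r ord0 k)%:E)%E) /\
    {ae leb, forall s, `[0%R, T]%classic s -> tF (y s) (v s)} /\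
    (\int[leb]_(s in `[0%R, T]%classic) (enorm (v s) ^+ 2)%:E <= (C ^+ 2)%:E)%E.

Definition tGamC (T C : R) : set (PathM R d) := [set y | exists x, tGam T C x y].

Definition clampP (T : R) (y : R -> vec R d) : R -> vec R d :=
  fun s => y (Num.min T (Num.max 0 s)).

Definition netL (Li : 'I_N -> vec R d -> R -> R) (Ls : R -> R) (x : vec R d) (t : R) : R :=
  if x == 0 then \big[Num.min/Ls t]_(i < N) Li i 0 t
  else \sum_(i < N) (if `[< ray' i x >] then Li i x t else 0).

Definition netG (Gi : 'I_N -> vec R d -> R) (Gs : R) (x : vec R d) : R :=
  if x == 0 then \big[Num.min/Gs]_(i < N) Gi i 0
  else \sum_(i < N) (if `[< ray' i x >] then Gi i x else 0).

Definition PG (m : probability (TG R d) R) : Prop := m net = 1%E.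

Definition integG (m : probability (TG R d) R) (f : vec R d -> R) : R :=
  fine (\int[m]_(x in net) (f x)%:E)%E.

Definition bcontG (f : vec R d -> R) : Prop :=
  {within net, continuous f} /\ exists M : R, forall x, net x -> `|f x| <= M.

(* continuity of Phi : P(G) -> (S -> R) (sup norm on S), P(G) with the
   narrow topology (initial topology of m |-> int f dm, f bounded continuous) *)
Definition narrow_cont {Y : Type} (S : set Y)
  (Phi : probability (TG R d) R -> Y -> R) : Prop :=
  forall m, PG m -> forall eps : R, 0 < eps ->
    exists n (fs : 'I_n -> vec R d -> R) (delta : R),
      0 < delta /\ (forall k, bcontG (fs k)) /\
      forall m', PG m' ->
        (forall k, `|integG m' (fs k) - integG m (fs k)| < delta) ->
        forall y, S y -> `|Phi m' y - Phi m y| <= eps.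

Definition C1net (T : R) (phi : vec R d -> R -> R)
  (Dx : 'I_N -> R -> R -> R) (Dt : vec R d -> R -> R) : Prop :=
  {within net `*` `[0%R, T]%classic, continuous (fun p => phi p.1 p.2)} /\
  forall i : 'I_N,
    {within `[0%R, +oo[%classic `*` `[0%R, T]%classic, continuous (fun p => Dx i p.1 p.2)} /\
    {within `[0%R, +oo[%classic `*` `[0%R, T]%classic, continuous (fun p => Dt (p.1 *: e i) p.2)} /\
    forall xb t, 0 <= xb -> 0 <= t <= T ->
      forall eps : R, 0 < eps -> exists2 del : R, 0 < del &
        forall xb' t', 0 <= xb' -> 0 <= t' <= T ->
          `|xb' - xb| < del -> `|t' - t| < del ->
          `|phi (xb' *: e i) t' - phi (xb *: e i) t
             - Dx i xb t * (xb' - xb) - Dt (xb *: e i) t * (t' - t)|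
            <= eps * (`|xb' - xb| + `|t' - t|).

Definition locmax (T : R) (f : vec R d -> R -> R) (x : vec R d) (t : R) : Prop :=
  exists2 r : R, 0 < r & forall z s, net z -> 0 <= s <= T ->
    gdist z x < r -> `|s - t| < r -> f z s <= f x t.
Definition locmin (T : R) (f : vec R d -> R -> R) (x : vec R d) (t : R) : Prop :=
  exists2 r : R, 0 < r & forall z s, net z -> 0 <= s <= T ->
    gdist z x < r -> `|s - t| < r -> f x t <= f z s.

Definition Lmu (L : 'I_N -> probability (TG R d) R -> vec R d -> R -> R)
  (Ls : probability (TG R d) R -> R -> R) (mu : probability (PathM R d) R)
  (x : vec R d) (t : R) : R :=
  netL (fun i => L i (mflow mu t)) (Ls (mflow mu t)) x t.

Definition gmu (Gi : 'I_N -> probability (TG R d) R -> vec R d -> R)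
  (Gs : probability (TG R d) R -> R) (T : R) (mu : probability (PathM R d) R)
  (x : vec R d) : R :=
  netG (fun i => Gi i (mflow mu T)) (Gs (mflow mu T)) x.

Definition tGamOpt (Lr : vec R d -> R -> R) (g : vec R d -> R) (T C : R)
  (x : vec R d) (y : R -> vec R d) : Prop :=
  tGam T C x y /\
  exists a : R -> ctrl, Gam T 0 x y a /\
    {ae leb, forall s, `[0%R, T]%classic s -> y s = 0 -> a s = (None, 0)} /\
    cost Lr g T 0 y a = infcost Lr g T 0 x.

End Network.

(* Hamiltonians; l stands for the value l_i(x,t) *)
Definition Hi {R : realType} (l p : R) : R :=
  sup [set - p * a - a ^+ 2 / 2 - l | a in [set: R]].
Definition Hdown {R : realType} (l p : R) : R :=
  sup [set - p * a - a ^+ 2 / 2 - l | a in `[0%R, +oo[%classic].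
(* H_O(t,p) with lO = l_O(t), ls i = l_i(O,t) *)
Definition HO {R : realType} {N : nat} (lO : R) (ls : 'I_N -> R) (p : 'I_N -> R) : R :=
  Num.max (- lO) (\big[Num.max/(- lO)]_(i < N) Hdown (ls i) (p i)).

(* Main.v *)
(** The equilibrium enters only through the flow m(t) of mu, which is concentrated on paths that are
    continuous, so t |-> m(t) is narrowly continuous and the frozen costs l_i(x,t), l_*(t) are bounded
    and continuous.  To use that mu charges the path space one must know that this set is measurable;
    it is closed for the uniform topology, by a weak compactness argument for velocities (minimal
    energy and the parallelogram law instead of weak limits) and Lebesgue differentiation.

    The rest is dynamic programming.  Constant controls give the subsolution inequalities.  For the
    supersolution inequalities the control of a near-optimal trajectory on [t, t+h] is only bounded in
    L^2, so its displacement delta need not be O(h); the pointwise inequality a^2/2 + q a + q^2/2 >= 0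
    with a constant q close to the derivative of the test function absorbs it.  At the vertex one
    splits [t, t+h] at the last time tau where the trajectory is at O: before tau the cost is at least
    l_O, after tau the trajectory stays on one ray, and a convex combination of the two bounds remains. *)
Require Import Defs.
From HB Require Import structures.
From mathcomp Require Import all_boot all_order all_algebra.
From mathcomp Require Import all_classical all_reals all_analysis measurable_realfun.
From mathcomp Require Import ring lra.
Import Order.TTheory GRing.Theory Num.Theory numFieldNormedType.Exports.
Set Implicit Arguments.
Unset Strict Implicit.
Unset Printing Implicit Defensive.

Local Open Scope classical_set_scope.
Local Open Scope ring_scope.

(** The running cost jumps at the vertex: its value at O is a minimum, which may lie strictly below
    the limits l_i(O,t) along the rays. Near O a lower bound by l_O holds everywhere, while l_i is
    the right constant on the open ray i. This is why the time before and the time after the last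
    visit to O are estimated apart, and it matches the two kinds of terms in H_O.

    The restriction to a >= 0 in the vertex Hamiltonian comes from a sign: seen from O the
    displacement along a ray is nonnegative, so any constant q <= p - eta is allowed, and q = min(p
    - eta, 0) yields min(p, 0)^2 / 2 instead of p^2 / 2. The shift by eta pays for the Taylor error
    of the test function, which is eta times the displacement and hence not O(h).

    On the path space, the tangency condition is not convex at O (a union of lines), so weak limits
    of velocities do not keep it. Only the energy bound and the primitives are passed to the limit;
    tangency is recovered afterwards from the fact that the limit path stays in the network. *)

Notation itg a b f := (leb.-integrable `[a, b]%classic (EFin \o f)).
Notation rint a b f := (\int[leb]_(s in `[a, b]%classic) f s).

(** * Integrals over compact intervals *)

Section IntervalIntegrals.
Context {R : realType}.
Implicit Types (a b c k : R) (f g : R -> R).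

Lemma leb_itvcc a b : a <= b -> leb `[a, b]%classic = (b - a)%:E.
Proof.
move=> ab; rewrite lebesgue_measure_itv /= lte_fin.
by case: ltP => // ba; rewrite (@le_anti _ _ a b) ?ab ?ba // subrr.
Qed.

Lemma leb_itvcc_lty a b : (leb `[a, b]%classic < +oo)%E.
Proof. by rewrite lebesgue_measure_itv /=; case: ifP => _ //; rewrite -EFinB ltry. Qed.

Lemma subset_itvcc a b a' b' : a <= a' -> b' <= b ->
  `[a', b']%classic `<=` (`[a, b]%classic : set R).
Proof.
by move=> aa bb s /=; rewrite !in_itv /= => /andP[u v]; rewrite (le_trans aa u) (le_trans v bb).
Qed.

Lemma itg_measurable a b f : itg a b f -> measurable_fun `[a, b] f.
Proof. by move=> /measurable_int /measurable_EFinP. Qed.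

Lemma itg_bounded a b f k : measurable_fun `[a, b] f ->
  (forall s, a <= s <= b -> `|f s| <= k) -> itg a b f.
Proof.
move=> mf fk; apply: measurable_bounded_integrable => //; first exact: leb_itvcc_lty.
exists k; split; first by rewrite num_real.
by move=> x kx s /= sab; rewrite (le_trans (fk _ _) (ltW kx)) //; move: sab; rewrite in_itv.
Qed.

Lemma itg_dominated a b f g : measurable_fun `[a, b] f -> itg a b g ->
  (forall s, a <= s <= b -> `|f s| <= g s) -> itg a b f.
Proof.
move=> mf ig fg; apply: le_integrable ig => //; first exact/measurable_EFinP.
move=> s /=; rewrite in_itv /= => /fg fgs; rewrite !lee_fin.
exact: le_trans fgs (ler_norm _).
Qed.

Lemma itg_cst a b k : itg a b (fun=> k).
Proof. by apply: (@itg_bounded _ _ _ `|k|). Qed.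

Lemma itgD a b f g : itg a b f -> itg a b g -> itg a b (fun s => f s + g s).
Proof. by move=> i1 i2; exact: (integrableD _ i1 i2). Qed.

Lemma itgZ a b k f : itg a b f -> itg a b (fun s => k * f s).
Proof. by move=> i1; exact: (integrableZl _ k i1). Qed.

Lemma itgS a b a' b' f : a <= a' -> b' <= b -> itg a b f -> itg a' b' f.
Proof. by move=> aa bb; apply: integrableS => //; exact: subset_itvcc. Qed.

Lemma rint_cst a b k : a <= b -> rint a b (fun=> k) = k * (b - a).
Proof. by move=> ab; rewrite Rintegral_cst //; congr (_ * _); rewrite -[RHS]/(fine (b - a)%:E) -leb_itvcc. Qed.

Lemma rintD a b f g : itg a b f -> itg a b g ->
  rint a b (fun s => f s + g s) = rint a b f + rint a b g.
Proof. by move=> i1 i2; rewrite RintegralD. Qed.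

Lemma rintZ a b k f : itg a b f -> rint a b (fun s => k * f s) = k * rint a b f.
Proof. by move=> i1; rewrite RintegralZl. Qed.

Lemma rint_EFin a b f : itg a b f ->
  (\int[leb]_(s in `[a, b]) (f s)%:E)%E = (rint a b f)%:E.
Proof.
move=> i; rewrite /Rintegral fineK //.
by have := integrable_fin_num _ i; apply.
Qed.

Lemma itv_splitcc a b c : a <= c <= b ->
  `[a, b]%classic = (`[a, c] `|` `]c, b])%classic :> set R.
Proof.
by move=> acb; rewrite -(@itv_bndbnd_setU _ _ _ (BRight c)) // bnd_simp; lra.
Qed.

(** For the extended integral measurability is enough, so that [gam_concat] can use this before
    integrability on the whole interval is known. *)
Lemma int_split a b c f : a <= c <= b -> measurable_fun `[a, b] f ->
  (\int[leb]_(s in `[a, b]) (f s)%:E =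
   \int[leb]_(s in `[a, c]) (f s)%:E + \int[leb]_(s in `[c, b]) (f s)%:E)%E.
Proof.
move=> acb mf; rewrite {1}(itv_splitcc acb) integral_setU //; last 2 first.
- by rewrite -(itv_splitcc acb); exact/measurable_EFinP.
- apply/disj_setPS => s [] /=; rewrite !in_itv /= => /andP[_ sc] /andP[cs _].
  by move: (lt_le_trans cs sc); rewrite ltxx.
congr (_ + _)%E; rewrite integral_itv_obnd_cbnd //; apply/measurable_EFinP.
apply: measurable_funS mf => // s /=; rewrite !in_itv /= => /andP[cs sb].
by rewrite sb (le_trans _ (ltW cs)) //; case/andP: acb.
Qed.

Lemma rint_split a b c f : a <= c <= b -> itg a b f ->
  rint a b f = rint a c f + rint c b f.
Proof.
move=> acb i; case/andP: (acb) => ac cb.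
apply: EFin_inj; rewrite EFinD -!rint_EFin; first exact: int_split (itg_measurable i).
- exact: itgS i.
- exact: itgS i.
- by [].
Qed.

Lemma aeS (P Q : R -> Prop) : {ae leb, forall s, P s} -> (forall s, P s -> Q s) ->
  {ae leb, forall s, Q s}.
Proof. by move=> + PQ; apply: negligibleS => s /= nQ; apply: contra_not nQ; exact: PQ. Qed.

Lemma aeI (P Q : R -> Prop) : {ae leb, forall s, P s} -> {ae leb, forall s, Q s} ->
  {ae leb, forall s, P s /\ Q s}.
Proof.
move=> nP nQ; have := negligibleU nP nQ; apply: negligibleS => s /= /not_andP[]; by [left|right].
Qed.

Lemma rint_ge0_ae a b f : itg a b f ->
  {ae leb, forall s, a <= s <= b -> 0 <= f s} -> 0 <= rint a b f.
Proof.
move=> i f0; rewrite /Rintegral fine_ge0 //.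
have mf := itg_measurable i.
have -> : (\int[leb]_(x in `[a, b]) (f x)%:E = \int[leb]_(x in `[a, b]) (Num.max (f x) 0)%:E)%E;
  last by apply: integral_ge0 => s _; rewrite lee_fin le_max lexx orbT.
apply: ae_eq_integral => //.
- exact/measurable_EFinP.
- by apply/measurable_EFinP; exact: measurable_maxr.
- apply: aeS f0 _ => s h /=; rewrite in_itv /= => /h fs0.
  by rewrite max_l.
Qed.

Lemma rint_le_ae a b f g : itg a b f -> itg a b g ->
  {ae leb, forall s, a <= s <= b -> f s <= g s} -> rint a b f <= rint a b g.
Proof.
move=> i1 i2 fg; rewrite -subr_ge0 -[- rint a b f]mulN1r -rintZ // -rintD //; last exact: itgZ.
apply: rint_ge0_ae; first by apply: itgD => //; exact: itgZ.
by apply: aeS fg _ => s h /h; rewrite mulN1r subr_ge0.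
Qed.

Lemma rint_le a b f g : itg a b f -> itg a b g ->
  (forall s, a <= s <= b -> f s <= g s) -> rint a b f <= rint a b g.
Proof. by move=> i1 i2 fg; apply: rint_le_ae => //; exact: aeW. Qed.

Lemma rint_eq_ae a b f g : itg a b f -> itg a b g ->
  {ae leb, forall s, a <= s <= b -> f s = g s} -> rint a b f = rint a b g.
Proof.
move=> i1 i2 fg; apply: le_anti.
by apply/andP; split; apply: rint_le_ae => //; apply: aeS fg _ => s h /h ->.
Qed.

Lemma eq_rint a b f g : (forall s, a <= s <= b -> f s = g s) -> rint a b f = rint a b g.
Proof. by move=> fg; apply: eq_Rintegral => s; rewrite inE /= in_itv /= => /fg. Qed.

Lemma eq_itg a b f g : (forall s, a <= s <= b -> f s = g s) -> itg a b f -> itg a b g.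
Proof.
by move=> fg; apply: eq_integrable => // s; rewrite inE /= in_itv /= => /fg ->.
Qed.

Lemma ae_neq (c : R) : {ae leb, forall s, s != c}.
Proof.
exists [set c]; split => //; first by rewrite lebesgue_measure_set1.
by move=> s /= /negP; rewrite negbK => /eqP.
Qed.

Lemma sqr_itg a b f : measurable_fun `[a, b] f ->
  (\int[leb]_(s in `[a, b]) (f s ^+ 2)%:E < +oo)%E -> itg a b (fun s => f s ^+ 2).
Proof.
move=> mf fi; apply/integrableP; split; first exact/measurable_EFinP/measurable_funX.
rewrite (_ : integral _ _ _ = (\int[leb]_(s in `[a, b]) (f s ^+ 2)%:E)%E) //.
by apply: eq_integral => s _ /=; rewrite ger0_norm // sqr_ge0.
Qed.

(** Young's inequality with a free weight; choosing [lam] suitably replaces the Cauchy-Schwarz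
    inequality throughout. *)
Lemma young_abs (lam x : R) : 0 < lam -> `|x| <= lam / 2 * x ^+ 2 + (2 * lam)^-1.
Proof.
move=> l0; rewrite -subr_ge0.
have -> : lam / 2 * x ^+ 2 + (2 * lam)^-1 - `|x| = (lam * `|x| - 1) ^+ 2 / (2 * lam).
  by rewrite -[x ^+ 2]real_normK ?num_real //; field; rewrite gt_eqF.
by rewrite divr_ge0 // ?sqr_ge0 // mulr_ge0 // ltW.
Qed.

Lemma itg_of_sqr a b f : measurable_fun `[a, b] f -> itg a b (fun s => f s ^+ 2) -> itg a b f.
Proof.
move=> mf i; apply: (@itg_dominated _ _ _ (fun s => 1 / 2 * f s ^+ 2 + (2 * 1)^-1)) => //.
  by apply: itgD; [exact: itgZ|exact: itg_cst].
by move=> s _; exact: young_abs.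
Qed.

Lemma rint_norm_le a b f : itg a b f -> `|rint a b f| <= rint a b (fun s => `|f s|).
Proof. by move=> i; exact: le_normr_Rintegral. Qed.

Lemma itg_norm a b f : itg a b f -> itg a b (fun s => `|f s|).
Proof.
move=> i; have mf := itg_measurable i.
apply: (le_integrable _ _ _ i) => //.
  by apply/measurable_EFinP; exact: measurableT_comp.
by move=> s _ /=; rewrite normr_id.
Qed.

Lemma rint_sqr_ge0 a b f : 0 <= rint a b (fun s => f s ^+ 2).
Proof. by apply: Rintegral_ge0 => s _; rewrite sqr_ge0. Qed.

(** The source of all equicontinuity below: [lam] is taken small relative to [M] first, then s' - s
    small relative to [lam]. *)
Lemma rint_abs_sqr_le a b f M lam s s' : measurable_fun `[a, b] f ->
  itg a b (fun r => f r ^+ 2) -> rint a b (fun r => f r ^+ 2) <= M -> 0 < lam ->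
  a <= s -> s <= s' -> s' <= b ->
  rint s s' (fun r => `|f r|) <= lam / 2 * M + (s' - s) / (2 * lam).
Proof.
move=> mf i2 hM l0 as_ ss sb.
have i1 : itg s s' f by apply: itgS (itg_of_sqr mf i2).
have i2' : itg s s' (fun r => f r ^+ 2) by apply: itgS i2.
apply: (@le_trans _ _ (rint s s' (fun r => lam / 2 * f r ^+ 2 + (2 * lam)^-1))).
  apply: rint_le; [exact: itg_norm|by apply: itgD; [exact: itgZ|exact: itg_cst]|].
  by move=> r _; exact: young_abs.
rewrite rintD ?rintZ ?rint_cst //; [|exact: itgZ|exact: itg_cst].
rewrite [(2 * lam)^-1 * _]mulrC lerD2r; apply: ler_wpM2l; first by rewrite divr_ge0 // ltW.
apply: le_trans hM.
rewrite (@rint_split a b s) ?as_ ?(le_trans ss sb) //.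
rewrite (@rint_split s b s') ?ss ?sb //; last by apply: itgS i2.
by rewrite addrCA lerDl addr_ge0 // rint_sqr_ge0.
Qed.

End IntervalIntegrals.

Notation cnear r z x := (forall k, `|z ord0 k - x ord0 k| < r).

(** * Geometry of the network: closed rays, and open rays that are relatively open *)

Section Geometry.
Context {R : realType} {d N : nat} (e : 'I_N -> vec R d).
Hypothesis e_unit : forall i, enorm (e i) = 1.
Hypothesis e_inj : injective e.
Implicit Types (x y z : vec R d) (i j : 'I_N) (s t r : R).

Definition ip z j : R := \sum_(k < d) z ord0 k * e j ord0 k.

Lemma enormZ s z : enorm (s *: z) = `|s| * enorm z.
Proof.
rewrite /enorm -sqrtr_sqr -sqrtrM ?sqr_ge0 // mulr_sumr.
by congr Num.sqrt; apply: eq_bigr => k _; rewrite mxE exprMn.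
Qed.

Lemma enorm0 : enorm (0 : vec R d) = 0.
Proof. by rewrite -(scale0r 0) enormZ normr0 mul0r. Qed.

Lemma sum_sqr_unit i : \sum_(k < d) e i ord0 k ^+ 2 = 1.
Proof.
rewrite -[LHS]sqr_sqrtr; first by rewrite -/(enorm _) e_unit expr1n.
by apply: sumr_ge0 => k _; rewrite sqr_ge0.
Qed.

Lemma unit_coord_le1 i k : `|e i ord0 k| <= 1.
Proof.
rewrite -(@ler_pXn2r _ 2) ?nnegrE // expr1n real_normK ?num_real //.
rewrite -(sum_sqr_unit i) (bigD1 k) //= lerDl.
by apply: sumr_ge0 => m _; rewrite sqr_ge0.
Qed.

Lemma ip_scale s j : ip (s *: e j) j = s.
Proof.
rewrite /ip -[RHS]mulr1 -(sum_sqr_unit j) mulr_sumr.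
by apply: eq_bigr => k _; rewrite mxE -mulrA -expr2.
Qed.

Lemma ip_le z j : `|ip z j| <= \sum_(k < d) `|z ord0 k|.
Proof.
rewrite (le_trans (ler_norm_sum _ _ _)) //; apply: ler_sum => k _.
by rewrite normrM ler_piMr // unit_coord_le1.
Qed.

Lemma scale_inj i s t : s *: e i = t *: e i -> s = t.
Proof. by move=> /(congr1 (ip^~ i)); rewrite !ip_scale. Qed.

Lemma coords_scale i s z : (forall k, z ord0 k = s * e i ord0 k) -> z = s *: e i.
Proof. by move=> h; apply/rowP => k; rewrite h mxE. Qed.

Lemma rayE i x : ray e i x <-> x = ip x i *: e i /\ 0 <= ip x i.
Proof. by split=> [[s s0 ->]|[xe s0]]; [rewrite ip_scale|exists (ip x i)]. Qed.

Lemma ray_ray' i x : ray e i x -> x <> 0 -> ray' e i x.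
Proof.
move=> [s + xs] x0; rewrite le_eqVlt => /predU1P[s0|s0]; last by exists s.
by case: x0; rewrite xs -s0 scale0r.
Qed.

Lemma ray'_ray i x : ray' e i x -> ray e i x.
Proof. by move=> [s s0 ->]; exists s => //; exact: ltW. Qed.

Lemma ray'_net i x : ray' e i x -> net e x.
Proof. by move=> /ray'_ray; exists i. Qed.

Lemma ray'_neq0 i x : ray' e i x -> x <> 0.
Proof.
move=> [s s0 ->] /(congr1 enorm); rewrite enormZ e_unit mulr1 enorm0.
by apply/eqP; rewrite normr_eq0 gt_eqF.
Qed.

Lemma ray_enorm i x : ray e i x -> x = enorm x *: e i.
Proof. by move=> [s s0 ->]; rewrite enormZ e_unit mulr1 ger0_norm. Qed.

(** A point of a ray is its norm times the direction, so a nonzero point determines the direction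
    and, by injectivity of [e], the index. *)
Lemma ray'_ray_uniq i j x : ray' e i x -> ray e j x -> i = j.
Proof.
move=> xi xj; apply: e_inj; apply: (@scalerI _ _ (enorm x)).
  case: xi => s s0 ->; rewrite enormZ e_unit mulr1 gtr0_norm //.
  by rewrite gt_eqF.
by transitivity x; [symmetry; apply: ray_enorm; exact: ray'_ray|exact: ray_enorm].
Qed.

Lemma ray'_uniq i j x : ray' e i x -> ray' e j x -> i = j.
Proof. by move=> xi /ray'_ray; exact: ray'_ray_uniq. Qed.

Lemma net_cases x : net e x -> x = 0 \/ exists i, ray' e i x.
Proof.
move=> [i xi]; have [->|/eqP x0] := eqVneq x 0; first by left.
by right; exists i; exact: ray_ray'.
Qed.

Lemma ray0 i : ray e i 0.
Proof. by exists 0 => //; rewrite scale0r. Qed.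

Lemma gdist_ray i s t : 0 <= s -> 0 <= t -> gdist e (s *: e i) (t *: e i) = `|s - t|.
Proof.
move=> s0 t0; rewrite /gdist; case: asboolP => [_|[]].
  by rewrite -scalerBl enormZ e_unit mulr1.
by exists i; split; [exists s|exists t].
Qed.

Lemma gdist0 x : net e x -> gdist e x 0 = enorm x.
Proof.
move=> [i [s s0 ->]]; rewrite -{1}(scale0r (e i)) gdist_ray //.
by rewrite subr0 enormZ e_unit mulr1.
Qed.

Lemma cnear_ball r z x : 0 < r -> cnear r z x -> ball x r z.
Proof.
move=> r0 h; split => // i k; rewrite /ball /= (ord1 i) distrC; exact: h.
Qed.

Lemma ball_cnear r z x : ball x r z -> cnear r z x.
Proof. by move=> [r0 h] k; have := h ord0 k; rewrite /ball /= distrC. Qed.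

Lemma coord_cont k : continuous (fun x : vec R d => x ord0 k).
Proof. exact: (@coord_continuous R 1 d ord0 k). Qed.

Lemma ip_continuous j : continuous (ip^~ j).
Proof.
move=> z A /nbhs_ballP[eps /= eps0 epsA].
have d1 : 0 < (d.+1)%:R :> R by rewrite ltr0n.
have r0 : 0 < eps / (d.+1)%:R by rewrite divr_gt0.
apply/nbhs_ballP; exists (eps / (d.+1)%:R) => // w /ball_cnear zw.
apply: epsA; rewrite /ball /=.
rewrite /ip -sumrB (le_lt_trans (ler_norm_sum _ _ _)) //.
apply: (@le_lt_trans _ _ (\sum_(k < d) eps / (d.+1)%:R)).
  apply: ler_sum => k _; rewrite -mulrBl normrM distrC.
  by rewrite (le_trans _ (ltW (zw k))) // ler_piMr // unit_coord_le1.
rewrite sumr_const card_ord -[X in X < _]mulr_natr mulrAC ltr_pdivrMr //.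
by rewrite ltr_pM2l // ltr_nat.
Qed.

(** A ray is cut out by the equation x = (x . e_i) e_i and the inequality x . e_i >= 0, both closed
    conditions. *)
Lemma closed_ray i : closed (ray e i).
Proof.
have -> : ray e i = \bigcap_(k in [set: 'I_d])
      ((fun x => x ord0 k - ip x i * e i ord0 k) @^-1` [set 0]) `&`
    (ip^~ i) @^-1` [set s | 0 <= s].
  apply/seteqP; split => x /=.
    by move=> /rayE[xe s0]; split => // k _ /=; rewrite {1}xe mxE subrr.
  move=> [h s0]; apply/rayE; split => //; apply: coords_scale => k.
  by apply/eqP; rewrite -subr_eq0; apply/eqP; exact: h.
apply: closedI.
  apply: closed_bigI => k _; apply: closed_comp.
    move=> x _; apply: (@cvgB _ _ _ (nbhs x)); first exact: (@coord_cont k x).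
    by apply: cvgM; [exact: ip_continuous|exact: cvg_cst].
  by apply: accessible_closed_set1; apply: hausdorff_accessible; exact: norm_hausdorff.
apply: closed_comp; first by move=> x _; exact: ip_continuous.
exact: closed_ge.
Qed.

Lemma netE : net e = \bigcup_(i in [set: 'I_N]) ray e i.
Proof. by apply/seteqP; split => x [i]; exists i. Qed.

Lemma closed_net : closed (net e).
Proof.
rewrite netE; apply: closed_bigcup; first exact: finite_finset.
by move=> i _; exact: closed_ray.
Qed.

(** The vertex and the finitely many other rays form a closed set that avoids x. *)
Lemma ray'_near i x : ray' e i x ->
  exists2 r, 0 < r & forall z, net e z -> cnear r z x -> ray' e i z.
Proof.
move=> xi.
have oU : open (~` ([set 0] `|` \bigcup_(j in [set j | j != i]) ray e j)).
  apply: closed_openC; apply: closedU.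
    by apply: accessible_closed_set1; apply: hausdorff_accessible; exact: norm_hausdorff.
  by apply: closed_bigcup; [exact: finite_finset|move=> j _; exact: closed_ray].
have : nbhs x (~` ([set 0] `|` \bigcup_(j in [set j | j != i]) ray e j)).
  apply: open_nbhs_nbhs; split => //= -[/(ray'_neq0 xi)//|[j /= /negP ji xj]].
  by apply: ji; rewrite (ray'_ray_uniq xi xj).
move=> /nbhs_ballP[r r0 rU]; exists r => // z [j zj] zx.
have /= nz := rU _ (cnear_ball r0 zx).
have z0 : z <> 0 by move=> z0; apply: nz; left.
have [<-|ji] := eqVneq j i; first exact: ray_ray'.
by exfalso; apply: nz; right; exists j.
Qed.

Lemma within_net_eps (T : R) (l : vec R d -> R -> R) x t eps :
  {within net e `*` `[0%R, T]%classic, continuous (fun p => l p.1 p.2)} ->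
  net e x -> 0 <= t <= T -> 0 < eps ->
  exists2 r, 0 < r & forall z s, net e z -> 0 <= s <= T -> cnear r z x ->
    `|s - t| < r -> `|l z s - l x t| < eps.
Proof.
move=> /subspace_continuousP lc xn tT eps0.
have /lc /cvgrPdist_lt /(_ _ eps0) : (net e `*` `[0%R, T]%classic) (x, t).
  by split => //=; rewrite in_itv.
rewrite /within /= => /nbhs_ballP[r /= r0 rU]; exists r => // z s zn sT zx st.
rewrite distrC; apply: (rU (z, s)).
  by split => /=; [exact: cnear_ball|rewrite /ball /= distrC].
by split => //=; rewrite in_itv.
Qed.

Lemma within_itv_eps (T : R) (l : R -> R) t eps :
  {within `[0%R, T]%classic, continuous l} -> 0 <= t <= T -> 0 < eps ->
  exists2 r, 0 < r & forall s, 0 <= s <= T -> `|s - t| < r -> `|l s - l t| < eps.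
Proof.
move=> /subspace_continuousP lc tT eps0.
have /lc /cvgrPdist_lt /(_ _ eps0) : `[0%R, T]%classic t by rewrite /= in_itv.
rewrite /within /= => /nbhs_ballP[r /= r0 rU]; exists r => // s sT st.
by rewrite distrC; apply: rU; rewrite /ball /= 1?distrC // in_itv.
Qed.

End Geometry.

(** * Admissible trajectories: increments, restriction and equicontinuity *)

Section Trajectories.
Context {R : realType} {d N : nat} (e : 'I_N -> vec R d).
Hypothesis e_unit : forall i, enorm (e i) = 1.
Hypothesis e_inj : injective e.
Variable T : R.
Implicit Types (x z : vec R d) (i : 'I_N) (s t r : R).

Definition ctrl_measurable (a b : R) (c : R -> @ctrl R N) :=
  (forall j, measurable ([set s | (c s).1 = j] `&` `[a, b]%classic)) /\
  measurable_fun `[a, b]%classic (fun s => (c s).2).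

Lemma ctrl_measurableS a b a' b' c : a <= a' -> b' <= b ->
  ctrl_measurable a b c -> ctrl_measurable a' b' c.
Proof.
move=> aa bb [mj mA]; split.
  move=> j; have -> : [set s | (c s).1 = j] `&` `[a', b']%classic =
      ([set s | (c s).1 = j] `&` `[a, b]%classic) `&` `[a', b']%classic.
    by rewrite -setIA; congr (_ `&` _); apply/esym/setIidPr; exact: subset_itvcc.
  by apply: measurableI => //; exact: mj.
by apply: measurable_funS mA => //; exact: subset_itvcc.
Qed.

Lemma fdyn_measurable a b c k : ctrl_measurable a b c ->
  measurable_fun `[a, b]%classic (fun s => fdyn e (c s) ord0 k).
Proof.
move=> [mj mA].
(* On [a, b] the dynamics is a finite sum over the rays, each term switched on by the measurable set
   of times at which its index is used; index 0 contributes zero. *)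
pose F i s := \1_([set s | (c s).1 = Some i] `&` `[a, b]%classic) s * ((c s).2 * e i ord0 k) : R.
have mF : measurable_fun `[a, b]%classic (fun s => \sum_(i < N) F i s).
  apply: measurable_sum => i; apply: measurable_funM.
    by apply: measurable_indic; exact: mj.
  by apply: measurable_funM.
apply: eq_measurable_fun mF => s; rewrite inE => sab.
have FE i : F i s = if (c s).1 == Some i then (c s).2 * e i ord0 k else 0.
  rewrite /F indicE; case: ifPn => [/eqP si|/eqP si].
    by rewrite mem_set ?mul1r //; split.
  by rewrite memNset ?mul0r // => -[].
under eq_bigr do rewrite FE; rewrite /fdyn; case: (c s) => -[i|] A /=; last first.
  by rewrite mxE big1 // => i; case: ifP.
rewrite mxE (bigD1 i) //= eqxx big1 ?addr0 // => j ji.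
by rewrite (_ : (Some i == Some j) = false) //; apply/negbTE; apply: contra ji => /eqP[->].
Qed.

Lemma fdyn_le (c : @ctrl R N) k : `|fdyn e c ord0 k| <= `|c.2|.
Proof.
rewrite /fdyn; case: c => -[i|] A /=; rewrite mxE ?normr0 //.
by rewrite normrM ler_piMr // unit_coord_le1.
Qed.

Section OneTrajectory.
Context {t : R} {x : vec R d} {y : R -> vec R d} {a : R -> @ctrl R N}.
Hypothesis tT : t <= T.
Hypothesis G : Gam e T t x y a.

Lemma gam_ctrl : ctrl_measurable t T a.
Proof. by case: G => _ [_ [? [? _]]]; split. Qed.

Lemma gam_net s : t <= s <= T -> net e (y s).
Proof. by case: G => _ [h _]; exact: h. Qed.

Lemma gam_sqr : itg t T (fun s => (a s).2 ^+ 2).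
Proof. by case: G => _ [_ [_ [? [? _]]]]; exact: sqr_itg. Qed.

Lemma gam_abs : itg t T (fun s => (a s).2).
Proof. by apply: itg_of_sqr gam_sqr; case: gam_ctrl. Qed.

Lemma gam_fdyn k : itg t T (fun s => fdyn e (a s) ord0 k).
Proof.
apply: itg_dominated (itg_norm gam_abs) _; first exact: fdyn_measurable gam_ctrl.
by move=> s _; exact: fdyn_le.
Qed.

Lemma gam_ode s k : t <= s <= T ->
  y s ord0 k = x ord0 k + rint t s (fun r => fdyn e (a r) ord0 k).
Proof.
case/andP=> ts sT; case: G => _ [_ [_ [_ [_ [_ h]]]]]; apply: EFin_inj.
rewrite h ?ts // rint_EFin //.
by apply: itgS (gam_fdyn k).
Qed.

Lemma gam_start : y t = x.
Proof.
apply/rowP => k; rewrite gam_ode ?lexx //.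
by rewrite set_itv1 Rintegral_set1 addr0.
Qed.

Lemma gam_incr s s' k : t <= s -> s <= s' -> s' <= T ->
  y s' ord0 k - y s ord0 k = rint s s' (fun r => fdyn e (a r) ord0 k).
Proof.
move=> ts ss sT.
rewrite !gam_ode ?ts ?(le_trans ss sT) ?(le_trans ts ss) //.
rewrite (@rint_split _ t s' s) ?ts //; first by ring.
by apply: itgS (gam_fdyn k).
Qed.

Lemma gam_equi M lam s s' k : rint t T (fun s => (a s).2 ^+ 2) <= M -> 0 < lam ->
  t <= s -> s <= s' -> s' <= T ->
  `|y s' ord0 k - y s ord0 k| <= lam / 2 * M + (s' - s) / (2 * lam).
Proof.
move=> hM l0 ts ss sT; rewrite gam_incr //.
have i1 : itg s s' (fun r => fdyn e (a r) ord0 k) by apply: itgS (gam_fdyn k).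
have [_ mA] := gam_ctrl.
rewrite (le_trans (rint_norm_le i1)) // (le_trans _ (rint_abs_sqr_le mA gam_sqr hM l0 ts ss sT)) //.
apply: rint_le; [exact: itg_norm|by apply: itgS (itg_norm gam_abs)|].
by move=> r _; exact: fdyn_le.
Qed.

(** On an open ray the constraint M forces the index i, so the velocity is the scalar control times
    e_i. The time s is left out of the hypothesis because the trajectory may then be at the vertex;
    a single time does not affect the integral. *)
Lemma gam_ray i s s' k : t <= s -> s <= s' -> s' <= T ->
  (forall r, s < r <= s' -> ray' e i (y r)) ->
  y s' ord0 k - y s ord0 k = rint s s' (fun r => (a r).2) * e i ord0 k.
Proof.
move=> ts ss sT yi; rewrite gam_incr // mulrC -rintZ; last by apply: itgS gam_abs.
apply: rint_eq_ae; first by apply: itgS (gam_fdyn k).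
  by apply: itgZ; apply: itgS gam_abs.
case: G => _ [_ [_ [_ [_ [hM _]]]]]; apply: aeS (aeI hM (ae_neq s)) _ => r [hr rs] /andP[sr rs'].
have yr : ray' e i (y r) by apply: yi; rewrite rs' andbT lt_neqAle eq_sym rs.
have [] := hr; first by rewrite /= in_itv /= (le_trans ts sr) (le_trans rs' sT).
move=> _ /(_ _ yr); rewrite /fdyn; case: (a r) => _ A /= ->.
by rewrite mxE mulrC.
Qed.

Lemma gam_restrict t' : t <= t' <= T -> Gam e T t' (y t') y a.
Proof.
move=> /andP[tt' t'T]; have [mj mA] := ctrl_measurableS tt' (lexx T) gam_ctrl.
case: G => _ [yn [_ [_ [_ [hM _]]]]].
have le s : t' <= s <= T -> t <= s <= T by move=> /andP[u ->]; rewrite (le_trans tt' u).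
split; first by apply: yn; rewrite tt'.
split; first by move=> s /le; exact: yn.
split=> //; split=> //; split.
  by rewrite rint_EFin ?ltry //; apply: itgS gam_sqr.
split.
  by apply: aeS hM _ => s h; rewrite /= in_itv /= => /le st; apply: h; rewrite /= in_itv.
move=> s /andP[ts sT] k; rewrite rint_EFin; last by apply: itgS (gam_fdyn k).
by rewrite -EFinD -gam_incr //; congr EFin; ring.
Qed.

End OneTrajectory.

(** The modulus depends on the energy bound alone, not on the trajectory or its initial time:
    [near_optimal] fixes the length h before it picks a trajectory. *)
Lemma gam_modulus (M eps : R) : 0 < eps -> exists2 del, 0 < del &
  forall t x y a, t <= T -> Gam e T t x y a ->
    rint t T (fun s => (a s).2 ^+ 2) <= M ->
    forall s s', t <= s <= T -> t <= s' <= T -> `|s' - s| < del -> cnear eps (y s') (y s).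
Proof.
move=> eps0.
pose M1 := `|M| + 1; have M10 : 0 < M1 by rewrite ltr_wpDl.
have [lam l0 lamE] : exists2 lam : R, 0 < lam & lam * M1 = eps.
  by exists (eps / M1); rewrite ?divr_gt0 // mulfVK // gt_eqF.
(* Since [lam] times [M1] is eps, the first term of [gam_equi] is eps / 2, and the second is below
   eps / 2 for time increments below eps * [lam]. *)
exists (eps * lam); first exact: mulr_gt0.
move=> t x y a tT G hM.
have hM1 : rint t T (fun s => (a s).2 ^+ 2) <= M1.
  by rewrite (le_trans hM) // (le_trans (ler_norm _)) // lerDl.
have key s s' k : t <= s -> s <= s' -> s' <= T -> s' - s < eps * lam ->
    `|y s' ord0 k - y s ord0 k| < eps.
  move=> ts ss sT sd; apply: le_lt_trans (gam_equi G k hM1 l0 ts ss sT) _.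
  have -> : lam / 2 * M1 = eps / 2 by rewrite -lamE mulrAC.
  rewrite [X in _ < X](splitr eps) ltrD2l ltr_pdivrMr ?mulr_gt0 //.
  by rewrite (_ : eps / 2 * (2 * lam) = eps * lam) //; field.
move=> s s' /andP[ts sT] /andP[ts' sT'] ss k.
have [le|/ltW le] := leP s s'.
  by apply: key => //; rewrite -[X in X < _]ger0_norm // subr_ge0.
by rewrite distrC; apply: key => //; rewrite -[X in X < _]ger0_norm ?subr_ge0 // distrC.
Qed.

(** Freezing time outside [a, b] turns a path on a compact interval into a continuous path on the
    line. *)
Definition clamp (a b s : R) := Num.min b (Num.max a s).

Lemma clamp_in a b s : a <= b -> a <= clamp a b s <= b.
Proof. by rewrite /clamp => ab; rewrite le_min ab !le_max lexx /= ge_min lexx. Qed.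

Lemma clamp_id a b s : a <= s <= b -> clamp a b s = s.
Proof. by move=> /andP[? ?]; rewrite /clamp max_r // min_r. Qed.

Lemma clamp_lip a b s s' : `|clamp a b s' - clamp a b s| <= `|s' - s|.
Proof.
have max_lip u v : u <= v -> 0 <= Num.max a v - Num.max a u <= v - u.
  by move=> uv; case: (leP a u) => au; case: (leP a v) => av; apply/andP; split; lra.
have min_lip u v : u <= v -> 0 <= Num.min b v - Num.min b u <= v - u.
  by move=> uv; case: (leP b u) => au; case: (leP b v) => av; apply/andP; split; lra.
have key u v : u <= v -> `|clamp a b v - clamp a b u| <= `|v - u|.
  move=> uv; have /andP[p0 p1] := max_lip _ _ uv.
  have /andP[q0 q1] : 0 <= clamp a b v - clamp a b u <= Num.max a v - Num.max a u.
    by apply: min_lip; rewrite -subr_ge0.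
  by rewrite (ger0_norm q0) (le_trans q1) // (le_trans p1) // ler_norm.
have [le|/ltW le] := leP s s'; first exact: key.
by rewrite distrC [X in _ <= X]distrC; exact: key.
Qed.

Lemma gam_continuous t x y a : t <= T -> Gam e T t x y a ->
  continuous (fun s => y (clamp t T s)).
Proof.
move=> tT G s A /nbhs_ballP[eps /= eps0 epsA].
have [del d0 h] := gam_modulus (rint t T (fun s => (a s).2 ^+ 2)) eps0.
apply/nbhs_ballP; exists del => // s' ss; apply: epsA; apply: cnear_ball => //.
apply: (h t x y a) => //; try exact: clamp_in.
by apply: le_lt_trans (clamp_lip _ _ _ _) _; rewrite distrC.
Qed.

End Trajectories.

(** * The value function and dynamic programming for bounded continuous costs *)

Section ValueFunction.
Context {R : realType} {d N : nat} (e : 'I_N -> vec R d).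
Hypothesis e_unit : forall i, enorm (e i) = 1.
Hypothesis e_inj : injective e.
Variables (T : R) (l : 'I_N -> vec R d -> R -> R) (ls : R -> R).
Variables (g : vec R d -> R) (K : R).
Hypothesis lc : forall i, {within net e `*` `[0%R, T]%classic, continuous (fun p => l i p.1 p.2)}.
Hypothesis lsc : {within `[0%R, T]%classic, continuous ls}.
Hypothesis lK : forall i x t, net e x -> 0 <= t <= T -> `|l i x t| <= K.
Hypothesis lsK : forall t, 0 <= t <= T -> `|ls t| <= K.
Hypothesis gK : forall x, net e x -> `|g x| <= K.
Implicit Types (s t r : R) (x z : vec R d) (i : 'I_N).

Local Notation Lr := (netL e l ls).

Lemma netL_ray i x t : ray' e i x -> Lr x t = l i x t.
Proof.
move=> xi; rewrite /netL; case: eqP => [/(ray'_neq0 e_unit xi)//|_].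
rewrite (bigD1 i) //= asboolT // big1 ?addr0 // => j ji; rewrite asboolF // => xj.
by move/eqP: ji; apply; exact: (ray'_uniq e_unit e_inj xj xi).
Qed.

Lemma netL0 t : Lr 0 t = \big[Num.min/ls t]_(i < N) l i 0 t.
Proof. by rewrite /netL eqxx. Qed.

Lemma net0 i : net e 0.
Proof. by exists i; exact: ray0. Qed.

Lemma netL_bound x t : net e x -> 0 <= t <= T -> `|Lr x t| <= K.
Proof.
move=> xn tT; case: (net_cases xn) => [x0|[i xi]]; last by rewrite (netL_ray _ xi) lK.
rewrite x0 netL0 -x0; elim/big_ind: _ => [|a b|i _]; [exact: lsK| |exact: lK].
by rewrite /Num.min; case: ifP.
Qed.

Lemma netL0_le i t : Lr 0 t <= l i 0 t.
Proof. by rewrite netL0; exact: bigmin_le_cond. Qed.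

Lemma bigmin_near (a b : R) (F F' : 'I_N -> R) eps : a - eps <= b ->
  (forall i, F i - eps <= F' i) ->
  \big[Num.min/a]_(i < N) F i - eps <= \big[Num.min/b]_(i < N) F' i.
Proof.
move=> ab FF; apply/bigmin_geP; split.
  by apply: le_trans ab; rewrite lerB // bigmin_le_id.
by move=> i _; apply: le_trans (FF i); rewrite lerB // bigmin_le_cond.
Qed.

Lemma netL_near_ray i x t eps : ray' e i x -> 0 <= t <= T -> 0 < eps ->
  exists2 r, 0 < r & forall z s, net e z -> 0 <= s <= T -> cnear r z x -> `|s - t| < r ->
    ray' e i z /\ `|Lr z s - l i x t| <= eps.
Proof.
move=> xi tT eps0.
have [r1 r10 h1] := within_net_eps (@lc i) (ray'_net xi) tT eps0.
have [r2 r20 h2] := ray'_near e_unit e_inj xi.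
exists (Num.min r1 r2); first by rewrite lt_min r10.
move=> z s zn sT zx; rewrite lt_min => /andP[st1 _].
have zi : ray' e i z.
  by apply: h2 => // k; have := zx k; rewrite lt_min => /andP[].
split => //; rewrite (netL_ray _ zi) ltW //; apply: h1 => // k.
by have := zx k; rewrite lt_min => /andP[].
Qed.

(** At the vertex the running cost is only lower semicontinuous in space. The three bounds are what
    survives: from below at every nearby point, two-sided in time at the vertex itself, and
    two-sided around l_i on each open ray. *)
Lemma netL_near0 t eps : (0 < N)%N -> 0 <= t <= T -> 0 < eps ->
  exists2 r, 0 < r & forall z s, net e z -> 0 <= s <= T -> cnear r z (0 : vec R d) -> `|s - t| < r ->
    [/\ Lr 0 t - eps <= Lr z s, `|Lr 0 s - Lr 0 t| <= eps &
       forall i, ray' e i z -> `|Lr z s - l i 0 t| <= eps].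
Proof.
move=> N0 tT eps0; have n0 : net e 0 by exact: net0 (Ordinal N0).
have [r0 r00 h0] := within_itv_eps lsc tT eps0.
have /choice[rr rrP] : forall i, exists r, 0 < r /\ forall z s, net e z -> 0 <= s <= T ->
    cnear r z (0 : vec R d) -> `|s - t| < r -> `|l i z s - l i 0 t| < eps.
  by move=> i; have [r p q] := within_net_eps (@lc i) n0 tT eps0; exists r.
pose r := \big[Num.min/r0]_(i < N) rr i.
have rr0 : r <= r0 by exact: bigmin_le_id.
have rri i : r <= rr i by exact: bigmin_le_cond.
exists r.
  by rewrite /r; elim/big_ind: _ => // [a b a0 b0|i _]; [rewrite lt_min a0|case: (rrP i)].
have z0s s : 0 <= s <= T -> `|s - t| < r -> forall i, `|l i 0 s - l i 0 t| < eps.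
  move=> sT st i; have [_ h] := rrP i; apply: h => //; last exact: lt_le_trans st _.
  by move=> k; rewrite subrr normr0; case: (rrP i).
have near0 s : 0 <= s <= T -> `|s - t| < r -> `|Lr 0 s - Lr 0 t| <= eps.
  move=> sT st; have ls_ := h0 _ sT (lt_le_trans st rr0).
  have li_ := z0s _ sT st.
  have dd (u v : R) : `|u - v| < eps -> u - eps <= v /\ v - eps <= u.
    by rewrite ltr_norml => /andP[? ?]; split; lra.
  have [p1 p2] := dd _ _ ls_.
  rewrite !netL0 ler_norml; apply/andP; split.
    rewrite lerBrDl.
    by apply: bigmin_near => // i; have [] := dd _ _ (li_ i).
  by rewrite lerBlDl -lerBlDr; apply: bigmin_near => // i; have [] := dd _ _ (li_ i).
move=> z s zn sT zx st.
have hi i : ray' e i z -> `|Lr z s - l i 0 t| <= eps.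
  move=> zi; rewrite (netL_ray _ zi); have [_ h] := rrP i; apply: ltW; apply: h => //.
    by move=> k; exact: lt_le_trans (zx k) (rri i).
  exact: lt_le_trans st _.
split; [|exact: near0|exact: hi].
case: (net_cases zn) => [->|[i zi]].
  by have := near0 _ sT st; rewrite ler_norml => /andP[p _]; lra.
have := hi _ zi; rewrite ler_norml => /andP[p _].
by have := netL0_le i t; lra.
Qed.

(** The cost along a continuous path may jump at visits to the vertex. The times at the vertex form
    a closed set, those on an open ray the difference of two closed sets, and on each piece the cost
    is continuous in time. *)
Lemma netL_measurable (c : R -> R) (y : R -> vec R d) :
  (forall s, 0 <= c s <= T) -> continuous c -> (forall s, net e (y s)) -> continuous y ->
  measurable_fun [set: R] (fun s => Lr (y s) (c s)).
Proof.
move=> cT cc yn yc.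
have lm i : measurable_fun [set: R] (fun s => l i (y s) (c s)).
  apply: continuous_measurable_fun => s A /nbhs_ballP[eps /= eps0 epsA].
  have [r r0 h] := within_net_eps (@lc i) (yn s) (cT s) eps0.
  have ny : nbhs s (y @^-1` ball (y s) r) by apply: yc; exact: nbhsx_ballx.
  have nc : nbhs s (c @^-1` ball (c s) r) by apply: cc; exact: nbhsx_ballx.
  apply: filterS (filterI ny nc) => s' [/ball_cnear ys' cs']; apply: epsA.
  by rewrite /ball /= distrC; apply: h => //; rewrite distrC.
have l0m i : measurable_fun [set: R] (fun s => l i 0 (c s)).
  apply: continuous_measurable_fun => s A /nbhs_ballP[eps /= eps0 epsA].
  have n0 := net0 i.
  have [r r0 h] := within_net_eps (@lc i) n0 (cT s) eps0.
  have nc : nbhs s (c @^-1` ball (c s) r) by apply: cc; exact: nbhsx_ballx.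
  apply: filterS nc => s' cs'; apply: epsA.
  rewrite /ball /= distrC; apply: h => //; last by rewrite distrC.
  by move=> k; rewrite subrr normr0.
have lsm : measurable_fun [set: R] (fun s => ls (c s)).
  apply: continuous_measurable_fun => s A /nbhs_ballP[eps /= eps0 epsA].
  have [r r0 h] := within_itv_eps lsc (cT s) eps0.
  have nc : nbhs s (c @^-1` ball (c s) r) by apply: cc; exact: nbhsx_ballx.
  apply: filterS nc => s' cs'; apply: epsA.
  by rewrite /ball /= distrC; apply: h => //; rewrite distrC.
have clm (A : set (vec R d)) : closed A -> measurable [set s | A (y s)].
  move=> cA; apply: closed_measurable; have := @closed_comp _ _ y A _ cA; apply.
  by move=> s _; exact: yc.
have c0 : measurable [set s | y s = 0].
  have -> : [set s | y s = 0] = \bigcap_(k in [set: 'I_d]) [set s | y s ord0 k = 0].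
    apply/seteqP; split => s /= => [ys k _|h]; first by rewrite /= ys mxE.
    by apply/rowP => k; rewrite mxE; exact: h.
  apply: closed_measurable; apply: closed_bigI => k _.
  apply: (@closed_comp _ _ (fun s => y s ord0 k) [set 0]).
    by move=> s _; apply: (@continuous_comp _ _ _ y (fun z : vec R d => z ord0 k)); [exact: yc|exact: coord_cont].
  by apply: accessible_closed_set1; apply: hausdorff_accessible; exact: norm_hausdorff.
rewrite /netL; apply: measurable_fun_ifT.
- apply: (measurable_fun_bool true); rewrite setTI.
  by have -> : (fun s => y s == 0) @^-1` [set true] = [set s | y s = 0]
    by apply/seteqP; split => s /= /eqP.
- have : forall (r : seq 'I_N), measurable_fun [set: R]
     (fun s => \big[Num.min/ls (c s)]_(i <- r) l i 0 (c s)); last exact.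
  elim => [|i r IH]; first by under eq_fun do rewrite big_nil.
  by under eq_fun do rewrite big_cons; exact: measurable_minr.
- apply: measurable_sum => i; apply: measurable_fun_ifT => //.
  apply: (measurable_fun_bool true); rewrite setTI.
  have -> : (fun s => `[< ray' e i (y s) >]) @^-1` [set true] =
      [set s | ray e i (y s)] `\` [set s | y s = 0].
    apply/seteqP; split => s /=.
      by move=> /asboolP yi; split; [exact: ray'_ray|exact: (ray'_neq0 e_unit yi)].
    by move=> [? ?]; apply/asboolP; exact: ray_ray'.
  by apply: measurableD => //; apply: clm; exact: closed_ray.
Qed.

Lemma clamp_continuous a b : continuous (@clamp R a b).
Proof.
move=> s A /nbhs_ballP[eps /= eps0 epsA]; apply/nbhs_ballP; exists eps => // s' ss.
by apply: epsA; rewrite /ball /= distrC; apply: le_lt_trans (clamp_lip _ _ _ _) _; rewrite distrC.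
Qed.

Local Notation cst_of y a := (fun s => Lr (y s) s + (a s).2 ^+ 2 / 2).

Lemma gam_netL t x y a : 0 <= t <= T -> Gam e T t x y a -> itg t T (fun s => Lr (y s) s).
Proof.
move=> /andP[t0 tT] G.
have le s : t <= s <= T -> 0 <= s <= T by move=> /andP[u ->]; rewrite (le_trans t0 u).
apply: (@itg_bounded _ _ _ _ K).
  have := @netL_measurable (clamp t T) (fun s => y (clamp t T s)) _ (@clamp_continuous t T)
    _ (gam_continuous e_unit tT G).
  move=> /(_ _ _)/(measurable_funS measurableT (@subsetT _ `[t, T]%classic)) h.
  apply: eq_measurable_fun (h _ _).
  - by move=> s; rewrite inE /= in_itv /= => sT; rewrite clamp_id.
  - by move=> s; apply: le; exact: clamp_in.
  - by move=> s; apply: (gam_net G); exact: clamp_in.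
by move=> s sT; apply: netL_bound; [exact: (gam_net G)|exact: le].
Qed.

Lemma gam_cost t x y a : 0 <= t <= T -> Gam e T t x y a -> itg t T (cst_of y a).
Proof.
move=> tT G; apply: itgD; first exact: gam_netL G.
have := itgZ (1 / 2) (gam_sqr G); apply: eq_itg => s _.
by rewrite mulrC mulrA mulr1.
Qed.

Lemma costE t x y a : 0 <= t <= T -> Gam e T t x y a ->
  cost Lr g T t y a = (rint t T (cst_of y a) + g (y T))%:E.
Proof. by move=> tT G; rewrite /cost rint_EFin //; exact: gam_cost G. Qed.

Lemma gam_costs t x y a : 0 <= t <= T -> Gam e T t x y a ->
  rint t T (cst_of y a) =
  rint t T (fun s => Lr (y s) s) + 1 / 2 * rint t T (fun s => (a s).2 ^+ 2).
Proof.
move=> tT G; rewrite -rintZ; last exact: gam_sqr G.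
rewrite -rintD; [|exact: gam_netL G|apply: itgZ; exact: gam_sqr G].
by apply: eq_rint => s _; rewrite [1 / 2 * _]mulrC mulrA mulr1.
Qed.

Lemma gam_netL_ge t x y a : 0 <= t <= T -> Gam e T t x y a ->
  - K * (T - t) <= rint t T (fun s => Lr (y s) s).
Proof.
move=> /andP[t0 tT] G; rewrite -rint_cst //; apply: rint_le; first exact: itg_cst.
  by apply: gam_netL G; rewrite t0.
move=> s /andP[ts sT]; have : `|Lr (y s) s| <= K.
  apply: netL_bound; first by apply: (gam_net G); rewrite ts.
  by rewrite sT (le_trans t0 ts).
by rewrite ler_norml => /andP[].
Qed.

(** A bound independent of the control. With the upper bound from a constant trajectory it makes the
    infimum finite, so [fine] in [valfun] returns the true value. *)
Lemma cost_lower t x y a : 0 <= t <= T -> Gam e T t x y a ->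
  - K * (T - t) - K <= rint t T (cst_of y a) + g (y T).
Proof.
move=> tT G; rewrite (gam_costs tT G).
have := gam_netL_ge tT G; have := rint_sqr_ge0 t T (fun s => (a s).2).
have : - K <= g (y T).
  have /gK : net e (y T) by apply: (gam_net G); case/andP: tT => _ ->; rewrite lexx.
  by rewrite ler_norml => /andP[].
lra.
Qed.

(** Provides a competitor from every starting point; at the vertex the control of index 0 is used,
    on a ray zero speed. *)
Lemma gam_cst t x : net e x -> t <= T -> exists a, Gam e T t x (fun=> x) a.
Proof.
move=> xn tT; have [c [cM c0]] : exists c : @ctrl R N, inM e x c /\ c.2 = 0.
  case: (net_cases xn) => [->|[i xi]].
    by exists (None, 0); split => //; split; [by case: xn => i _; exact: net0|
      move=> i /(ray'_neq0 e_unit)].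
  by exists (Some i, 0); split => //; split => // j xj; congr Some; exact: (ray'_uniq e_unit e_inj xi xj).
exists (fun=> c); split => //; split => //; split.
  move=> j; have [cj|cj] := pselect (c.1 = j).
    by rewrite (_ : [set _ | _] = setT) ?setTI //; apply/seteqP; split.
  by rewrite (_ : [set _ | _] = set0) ?set0I //; apply/seteqP; split.
split; first exact: measurable_cst.
split; first by rewrite c0 expr0n /= integral0 ltry.
split; first exact: aeW.
move=> s _ k; have -> : fdyn e c = 0.
  by rewrite /fdyn c0; case: c.1 => // i; rewrite scale0r.
by under eq_integral do rewrite mxE; rewrite integral0 adde0.
Qed.

Lemma valfun_le t x y a : 0 <= t < T -> Gam e T t x y a ->
  valfun e Lr g T x t <= rint t T (cst_of y a) + g (y T).
Proof.
move=> /andP[t0 tT] G; rewrite /valfun tT -lee_fin.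
have tT' : 0 <= t <= T by rewrite t0 ltW.
have ub : (infcost e Lr g T t x <= (rint t T (cst_of y a) + g (y T))%:E)%E.
  by apply: ereal_inf_lbound; exists y, a; split => //; rewrite (costE tT' G).
rewrite fineK // fin_numElt (le_lt_trans ub) ?ltry // andbT.
apply: (@lt_le_trans _ _ (- K * (T - t) - K)%:E); first exact: ltNyr.
apply: le_ereal_inf_tmp => _ [y' [a' [G' ->]]]; rewrite (costE tT' G') lee_fin.
exact: cost_lower G'.
Qed.

Lemma valfun_approx t x eps : 0 <= t < T -> net e x -> 0 < eps ->
  exists y a, Gam e T t x y a /\
    rint t T (cst_of y a) + g (y T) <= valfun e Lr g T x t + eps.
Proof.
move=> /andP[t0 tT] xn eps0; rewrite /valfun tT.
have tT' : 0 <= t <= T by rewrite t0 ltW.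
have [a0 G0] := gam_cst xn (ltW tT).
have f : infcost e Lr g T t x \is a fin_num.
  rewrite fin_numElt; apply/andP; split.
    apply: (@lt_le_trans _ _ (- K * (T - t) - K)%:E); first exact: ltNyr.
    apply: le_ereal_inf_tmp => _ [y' [a' [G' ->]]]; rewrite (costE tT' G') lee_fin.
    exact: cost_lower G'.
  apply: (@le_lt_trans _ _ (rint t T (cst_of (fun=> x) a0) + g x)%:E); last exact: ltry.
  by apply: ereal_inf_lbound; exists (fun=> x), a0; split => //; rewrite (costE tT' G0).
have [_ [y [a [G ->]]]] := lb_ereal_inf_adherent eps0 f.
rewrite -/(infcost _ _ _ _ _ _) (costE tT' G) => h; exists y, a; split => //.
by rewrite -lee_fin [X in (_ <= X)%E]EFinD (fineK f); exact: ltW.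
Qed.

(** The tail of the trajectory is a competitor for the problem started at (y t', t'). *)
Lemma dpp_lower t t' x y a : 0 <= t -> t <= t' -> t' < T -> Gam e T t x y a ->
  rint t t' (cst_of y a) + valfun e Lr g T (y t') t' <= rint t T (cst_of y a) + g (y T).
Proof.
move=> t0 tt' t'T G.
have t'T2 : 0 <= t' < T by rewrite t'T (le_trans t0 tt').
have tT : 0 <= t <= T by rewrite t0 (le_trans tt' (ltW t'T)).
have G' : Gam e T t' (y t') y a by apply: (gam_restrict e_unit G); rewrite tt' ltW.
rewrite (@rint_split _ t T t') ?tt' ?(ltW t'T) //; last exact: gam_cost G.
by rewrite -addrA lerD2l; exact: valfun_le G'.
Qed.

Lemma rint_tail a b f f' : itg a b f -> itg a b f' ->
  (forall s, a < s <= b -> f s = f' s) -> rint a b f = rint a b f'.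
Proof.
move=> i i' ff; apply: rint_eq_ae => //; apply: aeS (ae_neq a) _ => s sa /andP[las sb].
by apply: ff; rewrite sb andbT lt_neqAle eq_sym sa.
Qed.

(** * A constant control followed by an arbitrary admissible trajectory *)

Section Concatenation.
Variables (t t' : R) (x : vec R d) (c : @ctrl R N) (z : R -> vec R d) (b : R -> @ctrl R N).
Local Notation v := (fdyn e c).
Local Notation seg := (fun s => x + (s - t) *: v).
Hypotheses (t0 : 0 <= t) (tt' : t <= t') (t'T : t' < T).
Hypothesis segn : forall s, t <= s <= t' -> net e (seg s).
Hypothesis segM : forall s, t < s <= t' -> inM e (seg s) c.
Hypothesis G : Gam e T t' (seg t') z b.

Let Y s := if s <= t' then seg s else z s.
Let B s := if s <= t' then c else b s.

Let B_ctrl : ctrl_measurable t T B.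
Proof.
have [mj mA] := gam_ctrl G.
have tt'T : t <= t' <= T by rewrite tt' ltW.
split.
  (* The time t' belongs to the first piece, where the control is [c], so it is removed from the
     second. *)
  move=> j; have -> : [set s | (B s).1 = j] `&` `[t, T]%classic =
     ((if `[< c.1 = j >] then `[t, t']%classic else set0) `|`
      (([set s | (b s).1 = j] `&` `[t', T]%classic) `\ t')).
    apply/seteqP; split => s /=; rewrite /B !in_itv /=.
      case: (leP s t') => st' [sj /andP[ts sT]]; [left|right].
        by rewrite asboolT //= in_itv /= ts.
      by split; [split => //; rewrite sT ltW|move=> ss; move: st'; rewrite ss ltxx].
    move=> [|[[sj /andP[ts sT]] /eqP ss]].
      case: asboolP => [cj|//]; rewrite /= in_itv /= => /andP[-> st'].
      by rewrite st' (le_trans st' (ltW t'T)).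
    have st' : t' < s by rewrite lt_neqAle eq_sym ss.
    by rewrite leNgt st' /= (le_trans tt' ts) sT.
  apply: measurableU; first by case: asboolP.
  by apply: measurableD => //; exact: mj.
rewrite (itv_splitcc tt'T); apply/measurable_funU => //; split.
  apply: eq_measurable_fun (@measurable_cst _ _ _ _ _ c.2) => s.
  by rewrite inE /= in_itv /= /B => /andP[_ ->].
have : measurable_fun `]t', T]%classic (fun s => (b s).2).
  by apply: measurable_funS mA => // s /=; rewrite !in_itv /= => /andP[/ltW -> ->].
apply: eq_measurable_fun => s.
by rewrite inE /= in_itv /= /B => /andP[st _]; rewrite leNgt st.
Qed.

Lemma gam_concat : Gam e T t x Y B.
Proof.
have sB : ctrl_measurable t T B := B_ctrl.
have xn : net e x.
  by have := segn (s := t); rewrite lexx tt' subrr scale0r addr0; exact.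
have i1 : itg t t' (fun s => (B s).2 ^+ 2).
  by apply: eq_itg (itg_cst t t' (c.2 ^+ 2)) => s; rewrite /B => /andP[_ ->].
have [_ mB] := sB.
have mB2 : measurable_fun `[t, T]%classic (fun s => (B s).2 ^+ 2).
  by apply: measurable_funX.
have i2 : itg t' T (fun s => (B s).2 ^+ 2).
  (* At t' itself [B] equals [c] and not [b t']; the extra summand covers this one time. *)
  apply: (@itg_dominated _ _ _ _ (fun s => (b s).2 ^+ 2 + c.2 ^+ 2)).
  - by apply: measurable_funS mB2 => //; exact: subset_itvcc.
  - by apply: itgD; [exact: (gam_sqr G)|exact: itg_cst].
  - move=> s _; rewrite ger0_norm ?sqr_ge0 // /B; case: ifP => _.
      by rewrite lerDr sqr_ge0.
    by rewrite lerDl sqr_ge0.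
split => //; split.
  move=> s /andP[ts sT]; rewrite /Y; case: leP => st'; first by apply: segn; rewrite ts.
  by apply: (gam_net G); rewrite sT ltW.
split; first by case: sB.
split; first by [].
split.
  rewrite (@int_split _ t T t') ?tt' ?(ltW t'T) // (rint_EFin i1) (rint_EFin i2).
  by rewrite -EFinD ltry.
split.
  case: G => _ [_ [_ [_ [_ [hM _]]]]].
  apply: aeS (aeI hM (ae_neq t)) _ => s [hs st]; rewrite /= in_itv /= => /andP[ts sT].
  rewrite /Y /B; case: leP => st'; first by apply: segM; rewrite st' lt_neqAle eq_sym st ts.
  by apply: hs; rewrite /= in_itv /= sT ltW.
move=> s /andP[ts sT] k.
have iv s1 : s1 <= t' -> itg t s1 (fun r => fdyn e (B r) ord0 k).
  move=> st'; apply: eq_itg (itg_cst t s1 (v ord0 k)) => r /andP[_ rs].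
  by rewrite /B (le_trans rs st').
have vE s1 : t <= s1 -> s1 <= t' -> rint t s1 (fun r => fdyn e (B r) ord0 k) = v ord0 k * (s1 - t).
  move=> ts1 st'; rewrite -rint_cst //; apply: eq_rint => r /andP[_ rs].
  by rewrite /B (le_trans rs st').
rewrite /Y; case: (leP s t') => st'.
  by rewrite (rint_EFin (iv _ st')) vE // -EFinD !mxE mulrC.
have mf : measurable_fun `[t, s]%classic (fun r => fdyn e (B r) ord0 k).
  by apply: fdyn_measurable; apply: ctrl_measurableS sB.
have ib : itg t' s (fun r => fdyn e (b r) ord0 k).
  by apply: itgS (gam_fdyn e_unit G k).
have iB : itg t' s (fun r => fdyn e (B r) ord0 k).
  apply: (@itg_dominated _ _ _ _ (fun r => `|fdyn e (b r) ord0 k| + `|v ord0 k|)).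
  - by apply: measurable_funS mf => //; exact: subset_itvcc.
  - by apply: itgD; [exact: itg_norm|exact: itg_cst].
  - by move=> r _; rewrite /B; case: ifP => _; rewrite ?lerDl ?lerDr.
rewrite (@int_split _ t s t') ?tt' ?(ltW st') // (rint_EFin (iv _ (lexx _))) (rint_EFin iB).
rewrite vE // -!EFinD; congr EFin.
have -> : rint t' s (fun r => fdyn e (B r) ord0 k) = rint t' s (fun r => fdyn e (b r) ord0 k).
  by apply: rint_tail => // r /andP[tr _]; rewrite /B leNgt tr.
rewrite (gam_ode e_unit G) ?sT ?(ltW st') // !mxE; ring.
Qed.

Lemma concat_cost : rint t T (cst_of Y B) + g (Y T) =
  rint t t' (fun s => Lr (seg s) s + c.2 ^+ 2 / 2) + (rint t' T (cst_of z b) + g (z T)).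
Proof.
have tT : 0 <= t <= T by rewrite t0 (le_trans tt' (ltW t'T)).
have t'T2 : 0 <= t' <= T by rewrite (le_trans t0 tt') ltW.
have iY : itg t T (cst_of Y B) by exact: (gam_cost tT gam_concat).
rewrite (@rint_split _ t T t') ?tt' ?(ltW t'T) // {3}/Y leNgt t'T /= -addrA; congr (_ + (_ + _)).
  by apply: eq_rint => s /andP[_ st]; rewrite /Y /B st.
apply: rint_tail; first exact: itgS iY.
  exact: (gam_cost t'T2 G).
by move=> s /andP[ts _]; rewrite /Y /B leNgt ts.
Qed.

Lemma concat_le lam : (forall s, t <= s <= t' -> Lr (seg s) s <= lam) ->
  valfun e Lr g T x t <=
  (lam + c.2 ^+ 2 / 2) * (t' - t) + (rint t' T (cst_of z b) + g (z T)).
Proof.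
move=> hl; have tT : 0 <= t < T by rewrite t0 (le_lt_trans tt' t'T).
apply: le_trans (valfun_le tT gam_concat) _.
rewrite concat_cost lerD2r -rint_cst //; apply: rint_le; last 1 first.
- by move=> s hs; rewrite lerD2r hl.
- have tT' : 0 <= t <= T by rewrite t0 (le_trans tt' (ltW t'T)).
  have := gam_cost tT' gam_concat; move/(itgS (lexx t) (ltW t'T)).
  by apply: eq_itg => s /andP[_ st]; rewrite /Y /B st.
- exact: itg_cst.
Qed.

End Concatenation.

(** No minimiser is assumed at time t': the segment is continued by an eps-optimal trajectory, and
    eps is arbitrary. *)
Lemma dpp_upper t t' x c lam : 0 <= t -> t <= t' -> t' < T ->
  (forall s, t <= s <= t' -> net e (x + (s - t) *: fdyn e c)) ->
  (forall s, t < s <= t' -> inM e (x + (s - t) *: fdyn e c) c) ->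
  (forall s, t <= s <= t' -> Lr (x + (s - t) *: fdyn e c) s <= lam) ->
  valfun e Lr g T x t <=
  (lam + c.2 ^+ 2 / 2) * (t' - t) + valfun e Lr g T (x + (t' - t) *: fdyn e c) t'.
Proof.
move=> t0 tt' t'T sn sM hl; apply/ler_addgt0Pr => eps eps0.
have t'T2 : 0 <= t' < T by rewrite (le_trans t0 tt').
have xn' : net e (x + (t' - t) *: fdyn e c) by apply: sn; rewrite tt' lexx.
have [z [b [G h]]] := valfun_approx t'T2 xn' eps0.
apply: le_trans (concat_le t0 tt' t'T sn sM G hl) _.
by rewrite -addrA lerD2l.
Qed.

End ValueFunction.

(** * Bounds for the Hamiltonians *)

Section Hamiltonians.
Context {R : realType}.
Implicit Types l p a c : R.

Let ham_ub l p a : - p * a - a ^+ 2 / 2 - l <= p ^+ 2 / 2 - l.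
Proof. by have := sqr_ge0 (p + a); rewrite sqrrD !expr2; lra. Qed.

Lemma Hi_le l p c : (forall a, - p * a - a ^+ 2 / 2 - l <= c) -> Hi l p <= c.
Proof. by move=> h; apply: ge_sup => [|_ [a _ <-]]; [exists (- p * 0 - 0 ^+ 2 / 2 - l), 0|]. Qed.

Lemma Hi_ge l p : p ^+ 2 / 2 - l <= Hi l p.
Proof.
apply: sup_upper_bound; last by exists (- p) => //; rewrite !expr2; lra.
by split; [exists (- p * 0 - 0 ^+ 2 / 2 - l), 0|exists (p ^+ 2 / 2 - l) => _ [a _ <-]].
Qed.

Lemma Hdown_le l p c : (forall a, 0 <= a -> - p * a - a ^+ 2 / 2 - l <= c) -> Hdown l p <= c.
Proof.
move=> h; apply: ge_sup => [|_ [a /= + <-]]; last by rewrite in_itv /= andbT => /h.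
by exists (- p * 0 - 0 ^+ 2 / 2 - l), 0 => //=; rewrite in_itv /= lexx.
Qed.

(** Over a >= 0 the supremum is reached at the positive part of -p, which is - min(p, 0). *)
Lemma Hdown_ge l p : Num.min p 0 ^+ 2 / 2 - l <= Hdown l p.
Proof.
apply: sup_upper_bound.
  split; last by exists (p ^+ 2 / 2 - l) => _ [a _ <-].
  by exists (- p * 0 - 0 ^+ 2 / 2 - l), 0 => //=; rewrite in_itv /= lexx.
exists (- Num.min p 0) => /=; first by rewrite in_itv /= andbT oppr_ge0 ge_min lexx orbT.
by case: (leP p 0) => _; rewrite !expr2; lra.
Qed.

Lemma HO_le N lO (ls p : 'I_N -> R) c : - lO <= c ->
  (forall i, Hdown (ls i) (p i) <= c) -> HO lO ls p <= c.
Proof. by move=> h1 h2; rewrite /HO ge_max h1 /=; apply/bigmax_leP. Qed.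

Lemma HO_geO N lO (ls p : 'I_N -> R) : - lO <= HO lO ls p.
Proof. by rewrite /HO le_max lexx. Qed.

Lemma HO_ge N lO (ls p : 'I_N -> R) i : Hdown (ls i) (p i) <= HO lO ls p.
Proof. by rewrite /HO le_max; apply/orP; right; apply: le_bigmax_cond. Qed.

End Hamiltonians.

(** * The final arithmetic of the supersolution inequalities *)

Section RealInequalities.
Context {R : realType}.
Implicit Types p P q eta h delta : R.

(** The price of replacing the slope p by the shifted q is of order [eta]; eta <= 1 absorbs
    eta^2. *)
Lemma sqr_shift_le p q eta : 0 < eta <= 1 -> q = p - eta \/ q = p + eta ->
  q ^+ 2 <= p ^+ 2 + 2 * `|p| * eta + eta.
Proof.
move=> /andP[eta0 eta1] qE.
have e2 : eta ^+ 2 <= eta by rewrite expr2 ler_piMl // ltW.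
have pn : `|p * eta| = `|p| * eta by rewrite normrM (gtr0_norm eta0).
have := ler_norm (p * eta); have := ler_norm (- (p * eta)); rewrite normrN pn.
by case: qE => ->; rewrite ?sqrrD ?sqrrB; lra.
Qed.

(** The analogue at the vertex. [P] stands for a bound common to the slopes on all rays, because the
    ray reached by the trajectory may change with [eta]. *)
Lemma sqr_min_shift_le p P eta : `|p| <= P -> 0 < eta <= 1 ->
  Num.min (p - eta) 0 ^+ 2 <= Num.min p 0 ^+ 2 + 2 * P * eta + eta.
Proof.
move=> pP /andP[eta0 eta1].
have e2 : eta ^+ 2 <= eta by rewrite expr2 ler_piMl // ltW.
have pe : `|p * eta| <= P * eta by rewrite normrM (gtr0_norm eta0) ler_pM2r.
have := le_trans (ler_norm _) pe; have := ler_norm (- (p * eta)); rewrite normrN.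
have Pe : 0 <= P * eta by rewrite mulr_ge0 ?(le_trans _ pP) // ltW.
case: (leP p 0) => p0; case: (leP (p - eta) 0) => pq; rewrite ?sqrrB ?expr0n /=; try lra.
have pp : p ^+ 2 <= p * eta by rewrite expr2 ler_pM2l //; lra.
have pe0 : 0 <= p * eta by rewrite mulr_ge0 // ltW.
by lra.
Qed.

(** Here [ad] is the size of the displacement, which need not be O(h). The loss eta * ad in the
    expansion F4 cancels against the gain eta * ad in F1. What remains is proportional to h: three
    errors [eta] and half the excess of q^2, together at most eta (4 + |p|). *)
Lemma ray_inequality h eta p q delta ad lam D (v v' f f' I : R) : 0 < h -> 0 < eta ->
  q ^+ 2 <= p ^+ 2 + 2 * `|p| * eta + eta ->
  (lam - eta) * h - (p * delta - eta * ad) - q ^+ 2 / 2 * h <= I ->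
  I + v' <= v + h * eta -> v - f <= v' - f' ->
  - (eta * (ad + h)) <= f' - f - p * delta - D * h ->
  - (- D + (p ^+ 2 / 2 - lam)) <= eta * (4 + `|p|).
Proof.
move=> h0 eta0 q2 F1 F2 F3 F4; rewrite -(ler_pM2l h0).
have he : 0 <= h * eta by rewrite mulr_ge0 // ltW.
have hq : h * q ^+ 2 <= h * (p ^+ 2 + 2 * `|p| * eta + eta) by rewrite ler_pM2l.
by move: q2 => _; lra.
Qed.

(** [H] dominates - lO, and q^2 / 2 - li up to a multiple of [eta]. Weighting these bounds by [k1]
    and [k2], whose sum is h, gives h times [H]; the displacement terms cancel through the
    inequality on q * delta. *)
Lemma vertex_inequality h k1 k2 eta p q delta lO li D H P (v v' f f' I : R) :
  h = k1 + k2 -> 0 <= k1 -> 0 <= k2 -> 0 < h -> 0 < eta -> 0 <= P ->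
  q * delta <= p * delta - eta * delta ->
  q ^+ 2 <= Num.min p 0 ^+ 2 + 2 * P * eta + eta ->
  - lO <= H -> Num.min p 0 ^+ 2 / 2 - li <= H ->
  (lO - eta) * k1 + (li - eta) * k2 - q * delta - q ^+ 2 / 2 * k2 <= I ->
  I + v' <= v + h * eta -> v - f <= v' - f' ->
  - (eta * (delta + h)) <= f' - f - p * delta - D * h ->
  - (- D + H) <= eta * (4 + P).
Proof.
move=> hE k10 k20 h0 eta0 P0 qs q2 HO Hi F1 F2 F3 F4; rewrite -(ler_pM2l h0).
move: F2 F4; rewrite hE => F2 F4.
have E1 : k1 * - lO <= k1 * H by rewrite ler_wpM2l.
have E2 : k2 * (q ^+ 2 / 2 - li) <= k2 * (H + P * eta + eta / 2).
  by rewrite ler_wpM2l //; move: q2 Hi; clear; lra.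
have E3 : 0 <= k1 * (P * eta + eta / 2) by rewrite mulr_ge0 // addr_ge0 ?divr_ge0 ?mulr_ge0 // ltW.
have e1 : 0 <= k1 * eta by rewrite mulr_ge0 // ltW.
have e2 : 0 <= k2 * eta by rewrite mulr_ge0 // ltW.
by move: F1 F2 F3 F4 E1 E2 E3 e1 e2 qs; clear; lra.
Qed.

End RealInequalities.

(** * The sub- and supersolution inequalities, on open rays and at the vertex *)

Section Viscosity.
Context {R : realType} {d N : nat} (e : 'I_N -> vec R d).
Hypothesis e_unit : forall i, enorm (e i) = 1.
Hypothesis e_inj : injective e.
Variables (T : R) (l : 'I_N -> vec R d -> R -> R) (ls : R -> R).
Variables (g : vec R d -> R) (K : R).
Hypothesis lc : forall i, {within net e `*` `[0%R, T]%classic, continuous (fun p => l i p.1 p.2)}.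
Hypothesis lsc : {within `[0%R, T]%classic, continuous ls}.
Hypothesis lK : forall i x t, net e x -> 0 <= t <= T -> `|l i x t| <= K.
Hypothesis lsK : forall t, 0 <= t <= T -> `|ls t| <= K.
Hypothesis gK : forall x, net e x -> `|g x| <= K.
Implicit Types (s t r : R) (x z : vec R d) (i : 'I_N).

Local Notation Lr := (netL e l ls).
Local Notation u := (valfun e Lr g T).
Local Notation cst_of y a := (fun s => Lr (y s) s + (a s).2 ^+ 2 / 2).
Local Notation dpp_upper := (dpp_upper e_unit e_inj lc lsc lK lsK gK).

Variables (phi : vec R d -> R -> R) (Dx : 'I_N -> R -> R -> R) (Dt : vec R d -> R -> R).
Hypothesis C1 : C1net e T phi Dx Dt.

Lemma C1_expansion i xb t eps : 0 <= xb -> 0 <= t <= T -> 0 < eps ->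
  exists2 del, 0 < del & forall xb' t', 0 <= xb' -> 0 <= t' <= T ->
    `|xb' - xb| < del -> `|t' - t| < del ->
    `|phi (xb' *: e i) t' - phi (xb *: e i) t - Dx i xb t * (xb' - xb)
       - Dt (xb *: e i) t * (t' - t)| <= eps * (`|xb' - xb| + `|t' - t|).
Proof. by move=> xb0 tT eps0; case: C1 => _ /(_ i) [_ [_ h]]; exact: h. Qed.

(** One argument for three motions: along an open ray in either direction, away from the vertex, and
    rest at the vertex. This is why the control [c] and the speed [a] along e_i are given
    separately, with the cost bounded only along the segment. *)
Lemma sub_step i (c : @ctrl R N) a xb t lam : fdyn e c = a *: e i -> c.2 = a ->
  0 <= xb -> 0 < t < T ->
  locmax e T (fun z s => u z s - phi z s) (xb *: e i) t ->
  (exists2 h0, 0 < h0 & forall r, 0 < r <= h0 ->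
     0 <= xb + r * a /\ inM e ((xb + r * a) *: e i) c) ->
  (forall eta, 0 < eta -> exists2 h1, 0 < h1 & forall r, 0 <= r <= h1 ->
     Lr ((xb + r * a) *: e i) (t + r) <= lam + eta) ->
  - Dt (xb *: e i) t - Dx i xb t * a - a ^+ 2 / 2 - lam <= 0.
Proof.
move=> cv c2 xb0 /andP[t0 tT] [rm rm0 hm] [h0 h00 hseg] hL.
apply/ler_addgt0Pr => eps eps0; rewrite add0r.
have aa0 : 0 < `|a| + 2 by rewrite ltr_wpDl.
(* The errors are eta (h |a| + h) from the expansion of [phi] and eta h from the cost, in total h
   eps. *)
pose eta := eps / (`|a| + 2); have eta0 : 0 < eta by rewrite divr_gt0.
have [h1 h10 hl] := hL _ eta0.
have tT' : 0 <= t <= T by rewrite !ltW.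
have [del del0 hd] := C1_expansion i xb0 tT' eta0.
pose m := Num.min rm del; have m0 : 0 < m by rewrite lt_min rm0.
have [h hpos [[hh0 hh1 hT] hma]] : exists2 h : R, 0 < h &
    [/\ h <= h0, h <= h1 & h < T - t] /\ h * (`|a| + 2) < m.
  exists (Num.min (Num.min h0 h1) (Num.min ((T - t) / 2) (m / (2 * (`|a| + 2))))).
    by rewrite !lt_min h00 h10 !divr_gt0 ?subr_gt0 // mulr_gt0.
  split; first split.
  - by rewrite !ge_min lexx.
  - by rewrite !ge_min lexx orbT.
  - apply: (@le_lt_trans _ _ ((T - t) / 2)); first by rewrite !ge_min lexx !orbT.
    lra.
  - rewrite -ltr_pdivlMr //; apply: (@le_lt_trans _ _ (m / (2 * (`|a| + 2)))).
      by rewrite !ge_min lexx !orbT.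
    by rewrite ltr_pM2l // ltf_pV2 ?posrE ?mulr_gt0 // ltr_pMl // ltr1n.
have hm2 : h * 2 < m by apply: le_lt_trans hma; rewrite ler_pM2l // lerDr.
have hma1 : h * `|a| < m by apply: le_lt_trans hma; rewrite ler_pM2l // lerDl.
have segE s : xb *: e i + (s - t) *: fdyn e c = (xb + (s - t) * a) *: e i.
  by rewrite cv scalerA scalerDl.
have /dpp_upper up : 0 <= t by exact: ltW.
have := up (t + h) (xb *: e i) c (lam + eta).
have tth : t <= t + h by rewrite lerDl ltW.
have thT : t + h < T by rewrite -ltrBrDl.
have xbr r : 0 <= r <= h -> 0 <= xb + r * a.
  move=> /andP[r0 rh]; move: r0; rewrite le_eqVlt => /predU1P[<-|r0].
    by rewrite mul0r addr0.
  by apply: (hseg r _).1; rewrite r0 (le_trans rh).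
have rin s : t <= s <= t + h -> 0 <= s - t <= h.
  by rewrite subr_ge0 lerBlDl.
move=> /(_ tth thT) H.
have {H} /H : forall s, t <= s <= t + h -> net e (xb *: e i + (s - t) *: fdyn e c).
  by move=> s /rin sr; rewrite segE; exists i, (xb + (s - t) * a) => //; exact: xbr.
have {}segM : forall s, t < s <= t + h -> inM e (xb *: e i + (s - t) *: fdyn e c) c.
  move=> s /andP[ts sh]; rewrite segE; apply: (hseg _ _).2.
  by rewrite subr_gt0 ts /= (le_trans _ hh0) // lerBlDl.
move=> /(_ segM) H.
have {}/H : forall s, t <= s <= t + h -> Lr (xb *: e i + (s - t) *: fdyn e c) s <= lam + eta.
  move=> s /rin /andP[s0 sh]; rewrite segE -[X in Lr _ X](subrKC t).
  by apply: hl; rewrite s0 (le_trans sh).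
have -> : t + h - t = h by rewrite addrC addKr.
have := segE (t + h); rewrite (_ : t + h - t = h); last by rewrite addrC addKr.
move=> ->; rewrite c2 => H.
have x'0 : 0 <= xb + h * a by apply: xbr; rewrite lexx ltW.
have th0 : 0 <= t + h <= T by rewrite addr_ge0 ?ltW.
have dist : `|xb + h * a - xb| = h * `|a|.
  by rewrite addrC addKr normrM (gtr0_norm hpos).
have dt : `|t + h - t| = h by rewrite addrC addKr (gtr0_norm hpos).
have hm_ : h < m by apply: le_lt_trans hm2; rewrite ler_pMr // ler1n.
have := hm ((xb + h * a) *: e i) (t + h).
rewrite gdist_ray // dist dt => /(_ _ th0) HM.
have {HM} := HM _ (lt_le_trans hma1 _) (lt_le_trans hm_ _).
rewrite /m !ge_min lexx /= => /(_ _ isT isT) HM.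
have {}HM := HM (ex_intro _ i (ex_intro2 _ _ (xb + h * a) x'0 erefl)).
have := hd (xb + h * a) (t + h) x'0 th0.
rewrite dist dt => /(_ (lt_le_trans hma1 _) (lt_le_trans hm_ _)).
rewrite /m !ge_min lexx orbT => /(_ isT isT).
have -> : xb + h * a - xb = h * a by rewrite addrC addKr.
have -> : t + h - t = h by rewrite addrC addKr.
rewrite ler_norml => /andP[_ low].
rewrite -(ler_pM2l hpos).
have -> : h * eps = eta * (h * `|a| + h) + eta * h.
  by rewrite /eta; field; rewrite gt_eqF.
move: H HM low; lra.
Qed.

Lemma scale_dist i s s0 rho : cnear rho (s *: e i) (s0 *: e i) -> `|s - s0| <= d%:R * rho.
Proof.
move=> h; rewrite -(ip_scale e_unit (s - s0) i) (le_trans (ip_le e_unit _ _)) //.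
rewrite mulr_natl -[X in _ *+ X]card_ord -sumr_const; apply: ler_sum => k _.
by have := h k; rewrite !mxE -mulrBl => /ltW.
Qed.

(* Bounded running and terminal costs bound the energy of near-optimal controls, hence their
   trajectories are equicontinuous. *)
Lemma near_optimal t x eta rho : 0 < t < T -> net e x -> 0 < eta -> 0 < rho ->
  exists h y a, [/\ 0 < h < rho, t + h < T, Gam e T t x y a,
     (forall s, t <= s <= t + h -> cnear rho (y s) x) &
     rint t (t + h) (cst_of y a) + u (y (t + h)) (t + h) <= u x t + h * eta].
Proof.
move=> /andP[t0 tT] xn eta0 rho0.
(* Half the energy is at most the near-optimal cost minus the lower bounds - K T and - K. The
   constant must not depend on h, so h <= 1 is imposed and h * eta replaced by [eta]. *)
have [del del0 hdel] := gam_modulus e_unit T (2 * (u x t + eta + K * T + K)) rho0.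
have [h hpos [hr hT h1 hd]] : exists2 h : R, 0 < h & [/\ h < rho, h < T - t, h <= 1 & h < del].
  exists (Num.min (Num.min rho del) (Num.min (T - t) 1) / 2).
    by rewrite divr_gt0 // !lt_min rho0 del0 subr_gt0 tT ltr01.
  set mm := Num.min _ _.
  have mm0 : 0 < mm by rewrite !lt_min rho0 del0 subr_gt0 tT ltr01.
  have p1 : mm <= rho by rewrite !ge_min lexx.
  have p2 : mm <= del by rewrite !ge_min lexx orbT.
  have p3 : mm <= T - t by rewrite !ge_min lexx !orbT.
  have p4 : mm <= 1 by rewrite !ge_min lexx !orbT.
  by split; lra.
have thT : t + h < T by rewrite -ltrBrDl.
have tT2 : 0 <= t < T by rewrite ltW.
have tT3 : 0 <= t <= T by rewrite !ltW.
have [y [a [G hap]]] := valfun_approx e_unit e_inj lc lsc lK lsK gK tT2 xn (mulr_gt0 hpos eta0).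
exists h, y, a; split => //; first by rewrite hpos.
  have en : rint t T (fun s => (a s).2 ^+ 2) <= 2 * (u x t + eta + K * T + K).
    move: hap; rewrite (gam_costs e_unit e_inj lc lsc lK lsK tT3 G).
    have := gam_netL_ge e_unit e_inj lc lsc lK lsK tT3 G.
    have : - K <= g (y T).
      have /gK : net e (y T) by apply: (gam_net G); rewrite lexx ltW.
      by rewrite ler_norml => /andP[].
    have K0 : 0 <= K by apply: le_trans (gK xn).
    have : K * (T - t) <= K * T by rewrite ler_wpM2l // gerBl ltW.
    have : h * eta <= eta by rewrite ler_piMl // ltW.
    lra.
  move=> s /andP[ts sh] k; rewrite -(gam_start e_unit (ltW tT) G).
  apply: (hdel t x y a) => //; rewrite ?lexx ?ts ?(ltW tT) //=.
    by rewrite (le_trans sh) // ltW.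
  by rewrite ger0_norm ?subr_ge0 // (le_lt_trans _ hd) // lerBlDl.
apply: le_trans hap; apply: (dpp_lower e_unit e_inj lc lsc lK lsK gK (x := x)) => //.
  exact: ltW.
by rewrite lerDl ltW.
Qed.

(* Completes the square: a^2/2 + q a + q^2/2 >= 0 along the control on the last stretch. *)
Lemma rint_lower t tau t' x y a i lam1 lam2 q delta : 0 <= t -> t <= tau -> tau <= t' -> t' <= T ->
  Gam e T t x y a ->
  (forall s, t <= s <= tau -> lam1 <= Lr (y s) s) ->
  (forall s, tau < s <= t' -> lam2 <= Lr (y s) s) ->
  (forall s, tau < s <= t' -> ray' e i (y s)) ->
  (forall k, y t' ord0 k - y tau ord0 k = delta * e i ord0 k) ->
  lam1 * (tau - t) + lam2 * (t' - tau) - q * delta - q ^+ 2 / 2 * (t' - tau)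
    <= rint t t' (cst_of y a).
Proof.
move=> t0 tt tt' t'T G hl1 hl2 yi hde.
have tT : 0 <= t <= T by rewrite t0 (le_trans tt (le_trans tt' t'T)).
have iF : itg t t' (cst_of y a).
  by apply: itgS (gam_cost e_unit e_inj lc lsc lK lsK tT G).
have iA : itg tau t' (fun s => (a s).2) by apply: itgS (gam_abs G).
(* Both the given displacement and the integrated control are coefficients of the same nonzero
   vector e_i, so they agree. *)
have dE : delta = rint tau t' (fun s => (a s).2).
  apply: (scale_inj e_unit (i := i)); apply/rowP => k; rewrite !mxE -hde.
  exact: (gam_ray e_unit G).
rewrite (@rint_split _ t t' tau) ?tt // -addrA -addrA; apply: lerD.
  rewrite -rint_cst //; apply: rint_le; [exact: itg_cst|exact: itgS iF|].
  by move=> s ss; rewrite -[X in X <= _]addr0 lerD // ?hl1 // divr_ge0 // sqr_ge0.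
have -> : lam2 * (t' - tau) + (- (q * delta) - q ^+ 2 / 2 * (t' - tau)) =
    rint tau t' (fun s => (lam2 - q ^+ 2 / 2) + (- q) * (a s).2).
  rewrite rintD; [|exact: itg_cst|exact: itgZ].
  by rewrite rintZ // rint_cst // -dE; ring.
apply: rint_le_ae; [by apply: itgD; [exact: itg_cst|exact: itgZ]|exact: itgS iF|].
apply: aeS (ae_neq tau) _ => s st /andP[ts st'].
have : lam2 <= Lr (y s) s by apply: hl2; rewrite st' andbT lt_neqAle eq_sym st.
by have := sqr_ge0 ((a s).2 + q); rewrite sqrrD !expr2; lra.
Qed.

Lemma inM_ray' i z A : ray' e i z -> inM e z (Some i, A).
Proof.
move=> zi; split; first exact: ray'_net zi.
by move=> j zj; congr Some; exact: (ray'_uniq e_unit e_inj zi zj).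
Qed.

Lemma sub_ray i x t : ray' e i x -> 0 < t < T ->
  locmax e T (fun z s => u z s - phi z s) x t ->
  - Dt x t + Hi (l i x t) (Dx i (enorm x) t) <= 0.
Proof.
move=> xi /andP[t0 tT] hm.
have xE : x = enorm x *: e i by apply: ray_enorm => //; exact: ray'_ray.
have xb0 : 0 < enorm x.
  by case: xi => s s0 ->; rewrite enormZ e_unit mulr1 gtr0_norm.
rewrite -lerBrDl sub0r opprK; apply: Hi_le => a.
have A0 : 0 < `|a| + 1 by rewrite ltr_wpDl.
have tT' : 0 <= t <= T by rewrite !ltW.
(* For such r the displacement is at most half the distance to the vertex, so the segment stays on
   the open ray. *)
have pos r : 0 < r <= enorm x / (2 * (`|a| + 1)) -> 0 < enorm x + r * a.
  move=> /andP[r0 rh]; have : r * `|a| <= enorm x / 2.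
    apply: (@le_trans _ _ (enorm x / (2 * (`|a| + 1)) * (`|a| + 1))).
      by apply: ler_pM => //; [exact: ltW|rewrite lerDl].
    by rewrite invfM mulrA mulfVK // gt_eqF.
  have : - (r * `|a|) <= r * a by rewrite -mulrN ler_pM2l // lerNl -normrN ler_norm.
  lra.
have h00 : 0 < enorm x / (2 * (`|a| + 1)) by rewrite divr_gt0 // mulr_gt0.
have := @sub_step i (Some i, a) a (enorm x) t (l i x t) erefl erefl (ltW xb0).
rewrite t0 tT -xE => /(_ isT hm) H.
have {H} : - Dt x t - Dx i (enorm x) t * a - a ^+ 2 / 2 - l i x t <= 0.
  apply: H.
    exists (enorm x / (2 * (`|a| + 1))) => // r /pos rp; split; first exact: ltW.
    by apply: inM_ray'; exists (enorm x + r * a).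
  move=> eta eta0.
  have [r1 r10 h1] := netL_near_ray e_unit e_inj ls lc xi tT' eta0.
  exists (Num.min (enorm x / (2 * (`|a| + 1))) (Num.min (r1 / (2 * (`|a| + 1))) ((T - t) / 2))).
    by rewrite !lt_min h00 !divr_gt0 ?subr_gt0 // mulr_gt0.
  move=> r; rewrite !le_min => /andP[r0 /and3P[ra rb rc]].
  have rb' : r * (`|a| + 1) < r1.
    rewrite -ltr_pdivlMr // (le_lt_trans rb) // ltr_pM2l // ltf_pV2 ?posrE ?mulr_gt0 //.
    by rewrite ltr_pMl // ltr1n.
  have p0 : 0 <= enorm x + r * a.
    move: r0; rewrite le_eqVlt => /predU1P[<-|r0]; first by rewrite mul0r addr0 ltW.
    by apply/ltW/pos; rewrite r0.
  have [] := h1 ((enorm x + r * a) *: e i) (t + r).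
  - by exists i, (enorm x + r * a).
  - by apply/andP; split; lra.
  - move=> k; rewrite {2}xE !mxE -mulrBl addrC addKr normrM (normrM r) (ger0_norm r0).
    apply: le_lt_trans rb'; rewrite -mulrA ler_wpM2l //.
    by rewrite (le_trans (ler_piMr _ (unit_coord_le1 e_unit i k))) // lerDl.
  - rewrite addrC addKr ger0_norm // (le_lt_trans _ rb') // ler_peMr // lerDr //.
  - by move=> _; rewrite ler_norml => /andP[_]; rewrite lerBlDl.
by rewrite mulNr; lra.
Qed.

Lemma sub_vertex t : (0 < N)%N -> 0 < t < T ->
  locmax e T (fun z s => u z s - phi z s) 0 t ->
  - Dt 0 t + HO (Lr 0 t) (fun i => l i 0 t) (fun i => Dx i 0 t) <= 0.
Proof.
move=> N0 /andP[t0 tT] hm.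
have tT' : 0 <= t <= T by rewrite !ltW.
have zE i : (0 : R) *: e i = 0 by rewrite scale0r.
have stay : - Dt 0 t - Lr 0 t <= 0.
  pose i := Ordinal N0.
  have := @sub_step i (None, 0) 0 0 t (Lr 0 t).
  rewrite zE t0 tT !mulr0 expr0n /= mul0r !subr0 => H; apply: H => //.
    exists 1 => // r _; rewrite mulr0 addr0 zE; split => //; split; first by exists i; exact: ray0.
    by move=> j /(ray'_neq0 e_unit).
  move=> eta eta0; have [r1 r10 h1] := netL_near0 e_unit e_inj lc lsc N0 tT' eta0.
  exists (Num.min (r1 / 2) ((T - t) / 2)).
    by rewrite lt_min !divr_gt0 ?subr_gt0.
  move=> r; rewrite le_min => /andP[r0 /andP[ra rb]]; rewrite mulr0 addr0 zE.
  have [] := h1 0 (t + r).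
  - by exists i; exact: ray0.
  - by apply/andP; split; lra.
  - by move=> k; rewrite subrr normr0.
  - by rewrite addrC addKr ger0_norm //; lra.
  - by move=> _ + _; rewrite ler_norml => /andP[_]; rewrite lerBlDl.
rewrite -lerBrDl sub0r opprK; apply: HO_le.
  by move: stay; lra.
(* For a = 0 the vertex is not left and the running cost is l_O, not l_i; the bound for rest
   suffices because l_O <= l_i(O,t). *)
move=> i; apply: Hdown_le => a; rewrite le_eqVlt => /predU1P[<-|a0].
  move: stay; have := netL0_le e l ls i t.
  by rewrite mulr0 expr0n /=; lra.
have := @sub_step i (Some i, a) a 0 t (l i 0 t) erefl erefl (lexx _).
rewrite t0 tT zE => /(_ isT hm) H.
have {H} : - Dt 0 t - Dx i 0 t * a - a ^+ 2 / 2 - l i 0 t <= 0; last by rewrite mulNr; lra.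
apply: H.
  exists 1 => // r /andP[r0 _]; rewrite add0r; have ra0 : 0 < r * a by rewrite mulr_gt0.
  by split; [exact: ltW|apply: inM_ray'; exists (r * a)].
move=> eta eta0; have [r1 r10 h1] := netL_near0 e_unit e_inj lc lsc N0 tT' eta0.
exists (Num.min (r1 / (2 * (a + 1))) ((T - t) / 2)).
  by rewrite lt_min !divr_gt0 ?subr_gt0 // mulr_gt0 // addr_gt0.
move=> r; rewrite le_min => /andP[r0 /andP[ra rb]]; rewrite add0r.
have a10 : 0 < a + 1 by rewrite addr_gt0.
have rb' : r * (a + 1) < r1.
  rewrite -ltr_pdivlMr // (le_lt_trans ra) // ltr_pM2l // ltf_pV2 ?posrE ?mulr_gt0 //.
  by rewrite ltr_pMl // ltr1n.
(* At r = 0 the point is still the vertex, where l_O <= l_i(O,t) again gives the bound. *)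
move: r0; rewrite le_eqVlt => /predU1P[<-|r0].
  by rewrite mul0r zE addr0; have := netL0_le e l ls i t; lra.
have ra0 : 0 < r * a by rewrite mulr_gt0.
have [] := h1 ((r * a) *: e i) (t + r).
- by exists i, (r * a) => //; exact: ltW.
- by apply/andP; split; lra.
- move=> k; rewrite !mxE subr0 normrM (gtr0_norm ra0); apply: le_lt_trans rb'.
  rewrite (le_trans (ler_piMr (ltW ra0) (unit_coord_le1 e_unit i k))) //.
  by rewrite ler_pM2l // lerDl.
- by rewrite addrC addKr gtr0_norm // (le_lt_trans _ rb') // ler_peMr ?lerDr // ltW.
- move=> _ _ /(_ i); rewrite ler_norml => h; have /h/andP[_] : ray' e i ((r * a) *: e i).
    by exists (r * a).
  by rewrite lerBlDl.
Qed.

Lemma small_slack (A c : R) : 0 <= c -> (forall eta, 0 < eta <= 1 -> A <= eta * c) -> A <= 0.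
Proof.
move=> c0 h; apply/ler_addgt0Pr => eps eps0; rewrite add0r.
have c1 : 0 < c + 1 by rewrite ltr_wpDl.
apply: le_trans (h (Num.min 1 (eps / (c + 1))) _) _.
  by rewrite lt_min ltr01 divr_gt0 //= ge_min lexx.
apply: (@le_trans _ _ (eps / (c + 1) * (c + 1))); last by rewrite mulfVK // gt_eqF.
apply: ler_pM => //; first by rewrite le_min ler01 divr_ge0 // ltW.
  by rewrite ge_min lexx orbT.
by rewrite lerDl.
Qed.

(** By [scale_dist] the distance along a ray is at most d times the coordinatewise one; dividing by
    d + 1 makes the bound strict. *)
Lemma small_radius (m : R) : 0 < m -> exists2 rho, 0 < rho & rho <= m /\ d%:R * rho < m.
Proof.
move=> m0; have d0 : 0 < d.+1%:R :> R by rewrite ltr0n.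
exists (m / d.+1%:R); first by rewrite divr_gt0.
split; first by rewrite ler_pdivrMr // ler_peMr ?ler1n // ltW.
by rewrite mulrC mulrAC ltr_pdivrMr // ltr_pM2l // ltr_nat.
Qed.

Lemma super_ray i x t : ray' e i x -> 0 < t < T ->
  locmin e T (fun z s => u z s - phi z s) x t ->
  0 <= - Dt x t + Hi (l i x t) (Dx i (enorm x) t).
Proof.
move=> xi tT [rm rm0 hm]; case/andP: (tT) => t0 tT1.
have xn := ray'_net xi.
have xE : x = enorm x *: e i by apply: ray_enorm => //; exact: ray'_ray.
have xb0 : 0 <= enorm x by exact: sqrtr_ge0.
set p := Dx i (enorm x) t; set lam := l i x t.
have tT' : 0 <= t <= T by rewrite !ltW.
apply: (@le_trans _ _ (- Dt x t + (p ^+ 2 / 2 - lam))); last by rewrite lerD2l; exact: Hi_ge.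
rewrite -oppr_le0; apply: (@small_slack _ (4 + `|p|)); first by rewrite addr_ge0.
move=> eta /andP[eta0 eta1].
have [r1 r10 h1] := netL_near_ray e_unit e_inj ls lc xi tT' eta0.
have [del del0 hd] := C1_expansion i xb0 tT' eta0.
pose m := Num.min r1 (Num.min rm del).
have m0 : 0 < m by rewrite !lt_min r10 rm0.
have [rho rho0 [rhom drho]] := small_radius m0.
have rho1 : rho <= r1 by rewrite (le_trans rhom) // ge_min lexx.
have [drm drd] : d%:R * rho < rm /\ d%:R * rho < del.
  by split; apply: lt_le_trans drho _; rewrite !ge_min lexx !orbT.
have [rhorm rhodel] : rho <= rm /\ rho <= del.
  by split; apply: le_trans rhom _; rewrite !ge_min lexx !orbT.
have [h [y [a [/andP[h0 hrho] thT G near hle]]]] := near_optimal tT xn eta0 rho0.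
have tth : t <= t + h by rewrite lerDl ltW.
have inT s : t <= s <= t + h -> [/\ t <= s <= T, 0 <= s <= T & `|s - t| < rho].
  move=> /andP[ts sh]; have sT : s <= T by rewrite (le_trans sh) // ltW.
  rewrite ts sT (le_trans (ltW t0) ts); split => //.
  by rewrite ger0_norm ?subr_ge0 // (le_lt_trans _ hrho) // lerBlDl.
have good s : t <= s <= t + h -> ray' e i (y s) /\ lam - eta <= Lr (y s) s.
  move=> ss; have [sT sT' st] := inT _ ss.
  have [] := h1 (y s) s (gam_net G sT) sT'.
  - by move=> k; exact: lt_le_trans (near _ ss k) rho1.
  - exact: lt_le_trans st rho1.
  - move=> yi; rewrite ler_norml => /andP[q _]; split => //.
    by rewrite lerBlDr -lerBlDl; move: q; rewrite -/lam; lra.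
have end_ : t <= t + h <= t + h by rewrite tth lexx.
have [[s s0 ys] _] := good _ end_.
have s0' : 0 <= s by exact: ltW.
have ds : `|s - enorm x| <= d%:R * rho.
  by apply: (@scale_dist i) => k; rewrite -ys -xE; exact: near.
have [_ thT' htt] := inT _ end_.
have hh : t + h - t = h by rewrite addrC addKr.
have hmin : u x t - phi x t <= u (y (t + h)) (t + h) - phi (y (t + h)) (t + h).
  apply: hm => //; first by apply: ray'_net (good _ end_).1.
    by rewrite ys {1}xE gdist_ray //; exact: le_lt_trans ds drm.
  exact: lt_le_trans htt rhorm.
have := hd s (t + h) s0' thT' (le_lt_trans ds drd) (lt_le_trans htt rhodel).
rewrite -ys -xE hh (gtr0_norm h0) -/p ler_norml => /andP[low _].
(* The slope is shifted against the sign of the displacement, so that q times the displacement gives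
   up exactly [eta] times its absolute value. *)
pose q := if 0 <= s - enorm x then p - eta else p + eta.
have qE : q * (s - enorm x) = p * (s - enorm x) - eta * `|s - enorm x|.
  rewrite /q; case: ifPn => [c|]; first by rewrite ger0_norm //; ring.
  by rewrite -ltNge => c; rewrite ltr0_norm //; ring.
have q2 : q ^+ 2 <= p ^+ 2 + 2 * `|p| * eta + eta.
  apply: sqr_shift_le; first by rewrite eta0.
  by rewrite /q; case: ifP => _; [left|right].
(* Taking tau = t leaves no phase at the vertex: the whole stretch lies on the open ray. *)
have := @rint_lower t t (t + h) x y a i (lam - eta) (lam - eta) q (s - enorm x)
  (ltW t0) (lexx t) tth (ltW thT) G.
move=> H; have {H} := H _ _ _ _.
rewrite subrr mulr0 add0r hh => H.
have {H} : (lam - eta) * h - q * (s - enorm x) - q ^+ 2 / 2 * h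
    <= rint t (t + h) (cst_of y a).
  apply: H.
  - by move=> r /andP[tr rt]; apply: (good _ _).2; rewrite tr (le_trans rt).
  - by move=> r /andP[tr rt]; apply: (good _ _).2; rewrite rt ltW.
  - by move=> r /andP[tr rt]; apply: (good _ _).1; rewrite rt ltW.
  - move=> k; rewrite ys (gam_start e_unit (ltW tT1) G) {1}xE !mxE; ring.
rewrite qE => H; exact: ray_inequality h0 eta0 q2 H hle hmin low.
Qed.

(* tau is the last time off the open ray: the open rays are relatively open in the network, so at
   that time the trajectory can only be at the vertex. *)
Lemma last_exit t x y a i t1 : t <= T -> Gam e T t x y a -> t <= t1 <= T ->
  x = 0 -> ray e i (y t1) ->
  exists tau, [/\ t <= tau <= t1, y tau = 0 & forall s, tau < s <= t1 -> ray' e i (y s)].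
Proof.
move=> tT G /andP[tt1 t1T] x0 yi.
pose S := [set s | t <= s <= t1 /\ ~ ray' e i (y s)].
have yt : y t = 0 by rewrite (gam_start e_unit tT G).
have St : S t by split; [rewrite lexx|rewrite yt => /(ray'_neq0 e_unit)].
have Sub : has_sup S by split; [exists t|exists t1 => s [/andP[]]].
pose tau := sup S.
have ttau : t <= tau by exact: sup_upper_bound.
have taut1 : tau <= t1 by apply: ge_sup; [exists t|move=> s [/andP[]]].
have after s : tau < s <= t1 -> ray' e i (y s).
  move=> /andP[ts st]; apply: contrapT => ny.
  have : s <= tau by apply: sup_upper_bound => //; split => //; rewrite st (le_trans ttau) ?ltW.
  by rewrite leNgt ts.
exists tau; split => //; first by rewrite ttau.
have tauT : t <= tau <= T by rewrite ttau (le_trans taut1).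
(* If the trajectory is on an open ray at tau, it is on that same ray at all admissible times close
   to tau, earlier or later. *)
have local j : ray' e j (y tau) -> exists2 del, 0 < del &
    forall s, t <= s <= T -> `|s - tau| < del -> ray' e j (y s).
  move=> yj; have [r r0 hr] := ray'_near e_unit e_inj yj.
  have [del del0 hdel] := gam_modulus e_unit T (rint t T (fun s => (a s).2 ^+ 2)) r0.
  exists del => // s sT st; apply: hr; first exact: (gam_net G).
  exact: (hdel t x y a tT G (lexx _)).
(* Were it on the open ray j at tau, later times (or [yi], if tau = t1) would give j = i, and times
   of [S] arbitrarily close to the supremum would then be on the open ray i, against the definition
   of [S]. *)
case: (net_cases (gam_net G tauT)) => // -[j yj]; exfalso.
have [del del0 hdel] := local _ yj.
have ij : i = j.
  move: taut1; rewrite le_eqVlt => /predU1P[tE|taut1].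
    by apply/esym/(ray'_ray_uniq e_unit e_inj yj); rewrite tE.
  pose s := Num.min t1 (tau + del / 2).
  have ts : tau < s by rewrite lt_min taut1 ltrDl divr_gt0.
  have st : s <= t1 by rewrite ge_min lexx.
  apply: (ray'_uniq e_unit e_inj (x := y s)); first by apply: after; rewrite ts.
  apply: hdel; first by rewrite (le_trans ttau (ltW ts)) (le_trans st).
  rewrite gtr0_norm ?subr_gt0 // ltrBlDl (@le_lt_trans _ _ (tau + del / 2)) //.
    by rewrite ge_min lexx orbT.
  by rewrite ltrD2l; lra.
have [s Ss ts] := sup_adherent del0 Sub.
have st : s <= tau by exact: sup_upper_bound.
case: Ss => sS ny; apply: ny; rewrite ij; apply: hdel.
  by case/andP: sS => -> s1; rewrite (le_trans s1).
rewrite distrC ger0_norm ?subr_ge0 // ltrBlDl -ltrBlDr; exact: ts.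
Qed.

Lemma super_vertex t : (0 < N)%N -> 0 < t < T ->
  locmin e T (fun z s => u z s - phi z s) 0 t ->
  0 <= - Dt 0 t + HO (Lr 0 t) (fun i => l i 0 t) (fun i => Dx i 0 t).
Proof.
move=> N0 tT [rm rm0 hm]; case/andP: (tT) => t0 tT1.
have xn : net e 0 by exists (Ordinal N0); exact: ray0.
have tT' : 0 <= t <= T by rewrite !ltW.
set H := HO _ _ _.
(* The ray occupied at t + h is known only after [eta] is fixed, so the final constant has to cover
   every slope at the vertex. *)
pose P := \sum_(j < N) `|Dx j 0 t|.
have Pge j : `|Dx j 0 t| <= P.
  by rewrite /P (bigD1 j) //= lerDl sumr_ge0.
have P0 : 0 <= P by exact: sumr_ge0.
rewrite -oppr_le0; apply: (@small_slack _ (4 + P)); first by rewrite addr_ge0.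
move=> eta /andP[eta0 eta1].
have [r1 r10 h1] := netL_near0 e_unit e_inj lc lsc N0 tT' eta0.
have /choice[dl dlP] : forall i, exists del, 0 < del /\ forall xb' t', 0 <= xb' -> 0 <= t' <= T ->
    `|xb' - 0| < del -> `|t' - t| < del ->
    `|phi (xb' *: e i) t' - phi (0 *: e i) t - Dx i 0 t * (xb' - 0)
       - Dt (0 *: e i) t * (t' - t)| <= eta * (`|xb' - 0| + `|t' - t|).
  by move=> i; have [del p q] := C1_expansion i (lexx _) tT' eta0; exists del.
pose del := \big[Num.min/rm]_(i < N) dl i.
have delrm : del <= rm by exact: bigmin_le_id.
have deli i : del <= dl i by exact: bigmin_le_cond.
have del0 : 0 < del.
  by rewrite /del; elim/big_ind: _ => // [a b a0 b0|i _]; [rewrite lt_min a0|case: (dlP i)].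
pose m := Num.min r1 del.
have m0 : 0 < m by rewrite lt_min r10.
have [rho rho0 [rhom drho]] := small_radius m0.
have rho1 : rho <= r1 by rewrite (le_trans rhom) // ge_min lexx.
have drd : d%:R * rho < del by apply: lt_le_trans drho _; rewrite ge_min lexx orbT.
have rhodel : rho <= del by apply: le_trans rhom _; rewrite ge_min lexx orbT.
have [h [y [a [/andP[h0 hrho] thT G near hle]]]] := near_optimal tT xn eta0 rho0.
have tth : t <= t + h by rewrite lerDl ltW.
have inT s : t <= s <= t + h -> [/\ t <= s <= T, 0 <= s <= T & `|s - t| < rho].
  move=> /andP[ts sh]; have sT : s <= T by rewrite (le_trans sh) // ltW.
  rewrite ts sT (le_trans (ltW t0) ts); split => //.
  by rewrite ger0_norm ?subr_ge0 // (le_lt_trans _ hrho) // lerBlDl.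
have end_ : t <= t + h <= t + h by rewrite tth lexx.
have [endT thT' htt] := inT _ end_.
(* If the trajectory is at the vertex at t + h, any ray serves: then tau = t + h and the second
   phase has length zero. *)
have [i yi] := gam_net G endT.
have [tau [/andP[ttau taut] ytau after]] := last_exit (ltW tT1) G endT erefl yi.
have good s : t <= s <= t + h -> Lr 0 t - eta <= Lr (y s) s /\
    (ray' e i (y s) -> l i 0 t - eta <= Lr (y s) s).
  move=> ss; have [sT sT' st] := inT _ ss.
  have [] := h1 (y s) s (gam_net G sT) sT'.
  - by move=> k; exact: lt_le_trans (near _ ss k) rho1.
  - exact: lt_le_trans st rho1.
  - by move=> ? _ hi; split => // /hi; rewrite ler_norml => /andP[]; lra.
have [s s0 ys] := yi.
have zE : (0 : R) *: e i = 0 by rewrite scale0r.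
have ds : `|s - 0| <= d%:R * rho.
  by apply: (@scale_dist i) => k; rewrite -ys zE; exact: near.
have hh : t + h - t = h by rewrite addrC addKr.
have hmin : u 0 t - phi 0 t <= u (y (t + h)) (t + h) - phi (y (t + h)) (t + h).
  apply: hm => //; first by exact: (gam_net G).
    by rewrite ys -{1}zE gdist_ray //; exact: lt_le_trans (le_lt_trans ds drd) delrm.
  exact: lt_le_trans htt (le_trans rhodel delrm).
have [dli0 hd] := dlP i.
have := hd s (t + h) s0 thT' (lt_le_trans (le_lt_trans ds drd) (deli i))
  (lt_le_trans htt (le_trans rhodel (deli i))).
rewrite -ys zE hh (gtr0_norm h0) !subr0 (ger0_norm s0) ler_norml => /andP[low _].
(* The displacement s from the vertex is nonnegative, so only q <= p - eta is needed; the cut at 0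
   turns the completed square into the value of [Hdown]. *)
set p := Dx i 0 t in low *; pose q := Num.min (p - eta) 0.
have qs : q * s <= p * s - eta * s by rewrite -mulrBl ler_wpM2r // ge_min lexx.
have q2 : q ^+ 2 <= Num.min p 0 ^+ 2 + 2 * P * eta + eta.
  by apply: sqr_min_shift_le; rewrite ?eta0 //; exact: Pge.
have := @rint_lower t tau (t + h) 0 y a i (Lr 0 t - eta) (l i 0 t - eta) q s
  (ltW t0) ttau taut (ltW thT) G.
move=> F; have {}F : (Lr 0 t - eta) * (tau - t) + (l i 0 t - eta) * (t + h - tau)
    - q * s - q ^+ 2 / 2 * (t + h - tau) <= rint t (t + h) (cst_of y a).
  apply: F.
  - by move=> r /andP[tr rt]; apply: (good _ _).1; rewrite tr (le_trans rt).
  - move=> r rr; apply: (good _ _).2; last exact: after.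
    by case/andP: rr => tr ->; rewrite (le_trans ttau (ltW tr)).
  - exact: after.
  - by move=> k; rewrite ys ytau !mxE subr0.
have HOb : - Lr 0 t <= H by exact: HO_geO.
have Hib : Num.min p 0 ^+ 2 / 2 - l i 0 t <= H.
  by apply: le_trans (Hdown_ge _ _) _; exact: (HO_ge _ (fun i => l i 0 t) (fun i => Dx i 0 t)).
pose k1 := tau - t; pose k2 := t + h - tau.
have k10 : 0 <= k1 by rewrite subr_ge0.
have k20 : 0 <= k2 by rewrite subr_ge0.
have hE : h = k1 + k2 by rewrite /k1 /k2; ring.
exact: vertex_inequality hE k10 k20 h0 eta0 P0 qs q2 HOb Hib F hle hmin low.
Qed.

End Viscosity.

(** * Strong limits in L^2 and closure of velocities under uniform convergence of paths *)

Section L2Limits.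
Context {R : realType}.
Implicit Types (T : R).

Lemma sqr_itgD (a b : R) (f h : R -> R) : measurable_fun `[a, b] f -> measurable_fun `[a, b] h ->
  itg a b (fun s => f s ^+ 2) -> itg a b (fun s => h s ^+ 2) ->
  forall c c' : R, itg a b (fun s => (c * f s + c' * h s) ^+ 2).
Proof.
move=> mf mh i1 i2 c c'.
apply: (@itg_dominated _ _ _ _ (fun s => 2 * c ^+ 2 * f s ^+ 2 + 2 * c' ^+ 2 * h s ^+ 2)).
- apply: measurable_funX; apply: measurable_funD; apply: measurable_funM => //.
- by apply: itgD; exact: itgZ.
- move=> s _; rewrite ger0_norm ?sqr_ge0 //.
  have := sqr_ge0 (c * f s - c' * h s); rewrite sqrrB sqrrD !exprMn; lra.
Qed.

(** The increments are summable in L^1, so their absolute series is finite almost everywhere and,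
    added to the first term, dominates the sequence. This gives the pointwise limit and the
    convergence of primitives. *)
Lemma L2_limit T (w : nat -> R -> R) : 0 <= T ->
  (forall n, measurable_fun `[0, T] (w n)) -> (forall n, itg 0 T (fun s => w n s ^+ 2)) ->
  (forall n, rint 0 T (fun s => (w n.+1 s - w n s) ^+ 2) <= (2^-1 ^+ n) ^+ 2) ->
  exists v : R -> R, [/\ measurable_fun `[0, T] v, itg 0 T v,
    {ae leb, forall s, 0 <= s <= T -> w n s @[n --> \oo] --> v s} &
    forall s, 0 <= s <= T -> rint 0 s (w n) @[n --> \oo] --> rint 0 s v].
Proof.
move=> T0 mw iw hw.
have iw1 n : itg 0 T (w n) by exact: itg_of_sqr.
pose G n s := `|w n.+1 s - w n s|.
have mG n : measurable_fun `[0, T] (G n).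
  by apply: measurableT_comp => //; exact: measurable_funB.
have iG2 n : itg 0 T (fun s => (w n.+1 s - w n s) ^+ 2).
  have := sqr_itgD (mw n.+1) (mw n) (iw n.+1) (iw n) 1 (-1).
  by apply: eq_itg => s _; rewrite mul1r mulN1r.
have iG n : itg 0 T (G n).
  apply: itg_norm; apply: itg_of_sqr => //; exact: measurable_funB.
have half0 n : 0 < 2^-1 ^+ n :> R by rewrite exprn_gt0.
have IG n : rint 0 T (G n) <= (1 + T) / 2 * 2^-1 ^+ n.
  set q := 2^-1 ^+ n; have q0 : 0 < q by exact: half0.
  (* Young's inequality with weight 1 / q, q = 2^-n, makes both terms of order q. *)
  apply: (@le_trans _ _ (rint 0 T (fun s => q^-1 / 2 * (w n.+1 s - w n s) ^+ 2 + (2 * q^-1)^-1))).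
    apply: rint_le => //; first by apply: itgD; [exact: itgZ|exact: itg_cst].
    by move=> s _; apply: young_abs; rewrite invr_gt0.
  rewrite rintD ?rintZ ?rint_cst //; [|exact: itgZ|exact: itg_cst].
  have -> : (1 + T) / 2 * q = q^-1 / 2 * q ^+ 2 + (2 * q^-1)^-1 * (T - 0).
    by field; rewrite gt_eqF.
  by rewrite lerD2r; apply: ler_wpM2l; [rewrite divr_ge0 // invr_ge0 ltW|exact: hw].
pose g s := (\sum_(0 <= n <oo) (G n s)%:E)%E.
have mEG n : measurable_fun `[0%R, T]%classic (fun s => (G n s)%:E) by exact/measurable_EFinP.
have G0 n s : (0 <= (G n s)%:E)%E by rewrite lee_fin /G.
have mg : measurable_fun `[0%R, T]%classic g.
  have := @ge0_emeasurable_sum _ _ R `[0%R, T]%classic (fun n s => (G n s)%:E) xpredT.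
  by apply => // n s _ _; exact: G0.
have g0 s : (0 <= g s)%E by apply: nneseries_ge0 => n _ _; exact: G0.
have geo m : \sum_(0 <= n < m) (2^-1 ^+ n) <= 2 :> R.
  suff -> : \sum_(0 <= n < m) (2^-1 ^+ n) = 2 - 2 * 2^-1 ^+ m :> R.
    by have := half0 m; lra.
  elim: m => [|m IH]; first by rewrite big_nil expr0; ring.
  by rewrite big_nat_recr //= IH exprS; field.
have Ig : (\int[leb]_(s in `[0%R, T]%classic) g s <= (1 + T)%:E)%E.
  rewrite integral_nneseries //.
  apply: lime_le; first by apply: is_cvg_nneseries => n _ _; exact: integral_ge0.
  apply: nearW => m.
  under eq_bigr do rewrite (rint_EFin (iG _)).
  rewrite sumEFin lee_fin.
  apply: (@le_trans _ _ (\sum_(0 <= n < m) (1 + T) / 2 * 2^-1 ^+ n)).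
    by apply: ler_sum => n _; exact: IG.
  rewrite -mulr_sumr; apply: le_trans (ler_wpM2l _ (geo m)) _; last by rewrite mulfVK.
  by rewrite divr_ge0 // addr_ge0.
have ig : leb.-integrable `[0%R, T]%classic g.
  apply/integrableP; split => //.
  under eq_integral do rewrite gee0_abs //.
  by rewrite (le_lt_trans Ig) // ltry.
pose E := `[0%R, T]%classic `&` [set s | g s \is a fin_num].
have mE : measurable E by exact: emeasurable_fin_num.
have cvE s : E s -> cvgn (fun n => w n s).
  move=> [_ /= gf]; pose u := fun k => w k.+1 s - w k s.
  have su : series u = (fun n => w n s - w 0%N s).
    by apply/funext => n; rewrite /series /= telescope_sumr.
  have cu : cvgn (series u).
    apply: normed_cvg; apply: nondecreasing_is_cvgn.
      by apply: (@nondecreasing_series _ (fun n => `|u n|) xpredT 0%N) => n _ _; exact: normr_ge0.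
    exists (fine (g s)) => _ [n _ <-]; rewrite -lee_fin fineK // /series /= -sumEFin.
    by apply: (@nneseries_lim_ge _ (fun n => (G n s)%:E)).
  rewrite su in cu.
  have -> : (fun n => w n s) = (fun n => (w n s - w 0%N s) + w 0%N s).
    by apply/funext => n; rewrite subrK.
  by apply: is_cvgD => //; exact: is_cvg_cst.
(* Set to zero off [E], the sequence converges at every time, so the limit is measurable. *)
pose w' n s := \1_E s * w n s.
have w'E n s : E s -> w' n s = w n s by move=> Es; rewrite /w' indicE mem_set // mul1r.
have w'N n s : ~ E s -> w' n s = 0 by move=> Es; rewrite /w' indicE memNset // mul0r.
have cv' s : cvgn (fun n => w' n s).
  have [Es|Es] := pselect (E s).
    by under eq_fun do rewrite w'E //; exact: cvE.
  by under eq_fun do rewrite w'N //; exact: is_cvg_cst.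
pose v s := limn (fun n => w' n s).
have mv : measurable_fun `[0, T] v.
  apply: (@measurable_fun_cvg _ _ _ _ w') => [n|s _]; last exact: cv'.
  by apply: measurable_funM => //; exact: measurable_indic.
have aE : {ae leb, forall s, 0 <= s <= T -> E s}.
  have := integrable_ae _ ig.
  move=> /(_ (measurable_itv _))/aeS; apply => s h sT; split; [|apply: h]; by rewrite /= in_itv.
have aecv : {ae leb, forall s, 0 <= s <= T -> w n s @[n --> \oo] --> v s}.
  apply: aeS aE _ => s h /h Es; rewrite /v (_ : (fun n => w' n s) = (fun n => w n s)); first exact: cvE.
  by apply/funext => n; rewrite w'E.
have bnd n s : 0 <= s <= T -> (`|(w n s)%:E| <= `|w 0%N s|%:E + g s)%E.
  move=> sT; have -> : w n s = w 0%N s + \sum_(0 <= k < n) (w k.+1 s - w k s).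
    by rewrite telescope_sumr // addrC subrK.
  apply: (@le_trans _ _ (`|w 0%N s| + \sum_(0 <= k < n) G k s)%:E).
    rewrite /= lee_fin (le_trans (ler_normD _ _)) // lerD2l.
    exact: ler_norm_sum.
  rewrite EFinD leeD2l // -sumEFin.
  by apply: (@nneseries_lim_ge _ (fun n => (G n s)%:E)).
have dom s : 0 <= s <= T ->
   [/\ itg 0 s v, ([sequence (\int[leb]_(x in `[0%R, s]) `|(w n x)%:E - (v x)%:E|)%E]_n @ \oo --> 0%E) &
     (\int[leb]_(x in `[0%R, s]) (w n x)%:E)%E @[n --> \oo] --> (\int[leb]_(x in `[0%R, s]) (v x)%:E)%E].
  move=> /andP[s0 sT].
  have sub : `[0, s]%classic `<=` (`[0, T]%classic : set R) by exact: subset_itvcc.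
  have le x : `[0%R, s]%classic x -> 0 <= x <= T by move=> /sub; rewrite /= in_itv.
  apply: (@dominated_convergence _ _ _ leb `[0%R, s]%classic _ (fun n x => (w n x)%:E)
     (fun x => (v x)%:E) (fun x => (`|w 0%N x|)%:E + g x)%E) => //.
  - by move=> n; apply/measurable_EFinP; exact: measurable_funS (mw n).
  - by apply/measurable_EFinP; exact: measurable_funS mv.
  - apply: aeS aecv _ => x h /le /h wv.
    by apply: cvg_EFin => //; apply: nearW.
  - apply: integrableD => //; last exact: integrableS ig.
    by apply: integrableS (itg_norm (iw1 0%N)).
  - by apply: aeW => x n /le; exact: bnd.
exists v; split => //; first by have [] := dom T; rewrite ?lexx ?T0.
move=> s sT; have [i _ c] := dom _ sT.
have iws n : itg 0 s (w n) by apply: itgS (iw1 n) => //; case/andP: sT.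
have c' : (rint 0 s (w n))%:E @[n --> \oo] --> (rint 0 s v)%:E.
  by rewrite -(rint_EFin i); under eq_fun do rewrite -(rint_EFin (iws _)).
by apply: (@fine_cvg _ _ _ _ (fun n => (rint 0 s (w n))%:E)); exact: c'.
Qed.

Lemma fatou_ae T (f : nat -> R -> R) (F : R -> R) (c : R) :
  (forall n, itg 0 T (f n)) -> (forall n s, 0 <= f n s) -> (forall n, rint 0 T (f n) <= c) ->
  measurable_fun `[0, T] F -> (forall s, 0 <= F s) ->
  {ae leb, forall s, 0 <= s <= T -> f n s @[n --> \oo] --> F s} ->
  (\int[leb]_(s in `[0%R, T]) (F s)%:E <= c%:E)%E.
Proof.
move=> fi f0 fc mF F0 fF.
have mEf n : measurable_fun `[0%R, T]%classic (fun s => (f n s)%:E).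
  by apply/measurable_EFinP; exact: (itg_measurable (fi n)).
have mlim : measurable_fun `[0%R, T]%classic (fun s => limn_einf (fun n => (f n s)%:E)).
  have -> : (fun s => limn_einf (fun n => (f n s)%:E)) =
      (fun s => - limn_esup (fun n => - (f n s)%:E))%E.
    apply/funext => s; rewrite -limn_einfN; congr limn_einf.
    by apply/funext => n; rewrite /comp oppeK.
  apply: measurableT_comp => //; apply: measurable_fun_limn_esup => n.
  by apply: measurableT_comp.
have -> : (\int[leb]_(s in `[0%R, T]) (F s)%:E =
    \int[leb]_(s in `[0%R, T]) limn_einf (fun n => (f n s)%:E))%E.
  apply: ae_eq_integral => //; first exact/measurable_EFinP.
  apply: aeS fF _ => s h; rewrite /= in_itv /= => /h c1.
  have c2 : (f n s)%:E @[n --> \oo] --> (F s)%:E by apply: cvg_EFin => //; exact: nearW.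
  by rewrite (cvg_limn_einf_sup c2).1.
apply: le_trans (fatou leb (measurable_itv _) mEf _) _.
  by move=> n s _; rewrite lee_fin.
rewrite limn_einf_lim; apply: lime_le; first exact: is_cvg_einfs.
apply: nearW => n; apply: (@le_trans _ _ (\int[leb]_(s in `[0%R, T]) (f n s)%:E)%E).
  by apply: ereal_inf_lbound; exists n => //=.
by rewrite rint_EFin // lee_fin.
Qed.

Lemma ae_forall_ord n (P : 'I_n -> R -> Prop) : (forall k, {ae leb, forall s, P k s}) ->
  {ae leb, forall s, forall k, P k s}.
Proof.
move=> h; pose F m := if insub m is Some k then ~` [set s | P k s] else set0.
have : leb.-negligible (\bigcup_m F m).
  apply: negligible_bigcup => m; rewrite /F.
  by case: insubP => [k _ _|_]; [exact: h|exact: negligible_set0].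
apply: negligibleS => s /= /existsNP[k nP]; exists (nat_of_ord k) => //.
by rewrite /F valK.
Qed.

Lemma cvg_sum_ord n {X : Type} {F : set_system X} {FF : Filter F} (f : 'I_n -> X -> R) (a : 'I_n -> R) :
  (forall k, f k x @[x --> F] --> a k) ->
  \sum_(k < n) f k x @[x --> F] --> \sum_(k < n) a k.
Proof. by move=> h; apply: cvg_big => //; exact: add_continuous. Qed.

(** * Near-minimal energy among velocities whose primitives fit a given displacement [D] *)

Section WeakClosure.
Context {d : nat}.
Variables (T E0 : R) (D : 'I_d -> R -> R).
Hypothesis T0 : 0 <= T.
Implicit Types w : 'I_d -> R -> R.

Definition energy w : R := \sum_(k < d) rint 0 T (fun s => w k s ^+ 2).

Definition approx_velocity (eta : R) w :=
  [/\ forall k, measurable_fun `[0, T] (w k),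
     forall k, itg 0 T (fun s => w k s ^+ 2), energy w <= E0 &
     forall s, 0 <= s <= T -> forall k, `|rint 0 s (w k) - D k s| <= eta].

Lemma energy_ge0 w : 0 <= energy w.
Proof. by apply: sumr_ge0 => k _; exact: rint_sqr_ge0. Qed.

Lemma approx_velocityW eta eta' w : eta <= eta' -> approx_velocity eta w -> approx_velocity eta' w.
Proof. by move=> ee [? ? ? h]; split => // s sT k; exact: le_trans (h s sT k) ee. Qed.

(** [c] = 1 gives the midpoint, [c] = -1 the half difference. *)
Definition halfsum (c : R) w w' : 'I_d -> R -> R := fun k s => 1 / 2 * w k s + c / 2 * w' k s.

Lemma parallelogram w w' : (forall k, measurable_fun `[0, T] (w k)) ->
  (forall k, measurable_fun `[0, T] (w' k)) ->
  (forall k, itg 0 T (fun s => w k s ^+ 2)) -> (forall k, itg 0 T (fun s => w' k s ^+ 2)) ->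
  energy (halfsum 1 w w') + energy (halfsum (-1) w w') = 1 / 2 * (energy w + energy w').
Proof.
move=> m1 m2 i1 i2; rewrite /energy -!big_split mulr_sumr; apply: eq_bigr => k _ /=.
have is1 := sqr_itgD (m1 k) (m2 k) (i1 k) (i2 k).
rewrite -rintD ?is1 // -rintD // -rintZ; last exact: itgD.
by apply: eq_rint => s _; rewrite /halfsum; field.
Qed.

Lemma halfsum_approx eta w w' : approx_velocity eta w -> approx_velocity eta w' ->
  approx_velocity eta (halfsum 1 w w').
Proof.
move=> [m1 i1 e1 h1] [m2 i2 e2 h2].
split.
- by move=> k; apply: measurable_funD; exact: measurable_funM.
- by move=> k; exact: sqr_itgD.
- have := parallelogram m1 m2 i1 i2; have := energy_ge0 (halfsum (-1) w w'); lra.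
- move=> s sT k.
  have j1 : itg 0 s (w k).
    by apply: itgS (itg_of_sqr (m1 k) (i1 k)) => //; case/andP: sT.
  have j2 : itg 0 s (w' k).
    by apply: itgS (itg_of_sqr (m2 k) (i2 k)) => //; case/andP: sT.
  rewrite /halfsum rintD ?rintZ //; [|exact: itgZ|exact: itgZ].
  have := h1 s sT k; have := h2 s sT k; rewrite !ler_norml => /andP[a1 a2] /andP[a3 a4].
  by apply/andP; split; lra.
Qed.

(* The velocities fitting D up to eta form decreasing convex sets: near-minimizers of the energy are
   Cauchy in L^2 by the parallelogram law. *)
Lemma weak_closure : (forall eta, 0 < eta -> exists w, approx_velocity eta w) ->
  exists v : 'I_d -> R -> R,
    [/\ forall k, measurable_fun `[0, T] (v k), forall k, itg 0 T (v k),
       forall s, 0 <= s <= T -> forall k, rint 0 s (v k) = D k s &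
       (\int[leb]_(s in `[0%R, T]) (\sum_(k < d) v k s ^+ 2)%:E <= E0%:E)%E].
Proof.
move=> ex.
(* The lower bounds of the energy that hold from some tolerance on; the supremum is the limit of the
   minimal energies as the tolerance tends to zero. *)
pose S := [set r | exists2 eta, 0 < eta & forall w, approx_velocity eta w -> r <= energy w].
have S0 : S 0 by exists 1 => // w _; exact: energy_ge0.
have Sub : has_sup S.
  split; first by exists 0.
  exists E0 => r [eta eta0 h]; have [w aw] := ex _ eta0.
  by apply: le_trans (h _ aw) _; case: aw.
pose m := sup S.
(* The half difference of consecutive terms has energy at most 2 * [eps j], hence the difference at
   most 8 * [eps j], which is below the square of 2^-j. *)
pose eps j : R := (2^-1 ^+ j) ^+ 2 / 16.
have eps0 j : 0 < eps j by rewrite divr_gt0 // !exprn_gt0.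
have epsS j : eps j.+1 <= eps j.
  rewrite /eps [2^-1 ^+ j.+1]exprS exprMn; have : 0 < (2^-1 ^+ j : R) ^+ 2 by rewrite !exprn_gt0.
  by rewrite !expr2; lra.
have step j : exists p : R * ('I_d -> R -> R),
    [/\ 0 < p.1 <= j.+1%:R^-1, approx_velocity p.1 p.2, energy p.2 < m + eps j &
       forall w, approx_velocity p.1 w -> m - eps j <= energy w].
  have [r [eta eta0 h] mr] := sup_adherent (eps0 j) Sub.
  pose eta' := Num.min eta j.+1%:R^-1.
  have eta'0 : 0 < eta' by rewrite lt_min eta0 invr_gt0 ltr0n.
  have : ~ S (m + eps j).
    by move=> Sm; have := sup_upper_bound Sub Sm; rewrite -/m gerDl leNgt eps0.
  move=> nS; have [w aw ew] : exists2 w, approx_velocity eta' w & energy w < m + eps j.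
    apply: contrapT => nw; apply: nS; exists eta' => // w aw; rewrite leNgt.
    by apply/negP => ew; apply: nw; exists w.
  exists (eta', w); split => //=; first by rewrite eta'0 ge_min lexx orbT.
  move=> w' aw'; apply: le_trans (ltW mr) _; apply: h.
  by apply: approx_velocityW aw'; rewrite ge_min lexx.
have [p hp] := choice step.
pose w j := (p j).2.
have mw j k : measurable_fun `[0, T] (w j k) by have [_ [h _ _ _] _ _] := hp j; exact: h.
have iw j k : itg 0 T (fun s => w j k s ^+ 2) by have [_ [_ h _ _] _ _] := hp j; exact: h.
have half_le j : energy (halfsum (-1) (w j) (w j.+1)) <= 2 * eps j.
  have [[_ aj ej lj] [_ aj' ej' lj']] := (hp j, hp j.+1).
  have pl := parallelogram (mw j) (mw j.+1) (iw j) (iw j.+1).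
  have : m - eps j <= energy (halfsum 1 (w j) (w j.+1)).
    (* The midpoint fits [D] up to the larger of the two tolerances, so the lower bound belonging to
       that one is used. *)
    have [le|/ltW le] := leP (p j).1 (p j.+1).1.
      apply: (@le_trans _ _ (m - eps j.+1)); first by rewrite lerB.
      by apply: lj'; apply: halfsum_approx => //; exact: approx_velocityW aj.
    by apply: lj; apply: halfsum_approx => //; exact: approx_velocityW aj'.
  have := epsS j; move: ej ej' pl; rewrite -/(w j) -/(w j.+1); lra.
have diff_le k j : rint 0 T (fun s => (w j.+1 k s - w j k s) ^+ 2) <= (2^-1 ^+ j) ^+ 2.
  have ih := sqr_itgD (mw j k) (mw j.+1 k) (iw j k) (iw j.+1 k) (1 / 2) (-1 / 2).
  have -> : rint 0 T (fun s => (w j.+1 k s - w j k s) ^+ 2) =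
      4 * rint 0 T (fun s => (halfsum (-1) (w j) (w j.+1) k s) ^+ 2).
    by rewrite -rintZ //; apply: eq_rint => s _; rewrite /halfsum; field.
  apply: (@le_trans _ _ (4 * energy (halfsum (-1) (w j) (w j.+1)))).
    rewrite ler_pM2l // /energy (bigD1 k) //= lerDl.
    by apply: sumr_ge0 => i _; exact: rint_sqr_ge0.
  have := half_le j; rewrite /eps; have : 0 < (2^-1 ^+ j : R) ^+ 2 by rewrite !exprn_gt0.
  lra.
have /choice[v hv] : forall k, exists v : R -> R, [/\ measurable_fun `[0, T] v, itg 0 T v,
    {ae leb, forall s, 0 <= s <= T -> w n k s @[n --> \oo] --> v s} &
    forall s, 0 <= s <= T -> rint 0 s (w n k) @[n --> \oo] --> rint 0 s v].
  by move=> k; apply: (L2_limit T0 (w := fun n => w n k)) => //; exact: diff_le.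
have mv k : measurable_fun `[0, T] (v k) by case: (hv k).
exists v; split => //; first by move=> k; case: (hv k).
  move=> s sT k; have [_ _ _ /(_ _ sT) c] := hv k.
  apply: (cvg_unique _ c) => //; apply/cvgrPdist_le => e e0; near=> n.
  have [/andP[_ p1] [_ _ _ /(_ _ sT k) h] _ _] := hp n.
  rewrite distrC (le_trans h) // (le_trans p1) //; near: n.
  have := @cvg_harmonic R; move/cvgrPdist_le => /(_ _ e0); apply: filterS => n.
  by rewrite sub0r normrN /harmonic /= gtr0_norm // invr_gt0.
apply: (@fatou_ae T (fun n s => \sum_(k < d) w n k s ^+ 2)).
- move=> n; have : leb.-integrable `[0%R, T]%classic (fun s => \sum_(k < d) (w n k s ^+ 2)%:E)%E.
    by apply: integrable_sum => // k _; exact: iw.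
  by apply: eq_integrable => // s _; rewrite sumEFin.
- by move=> n s; apply: sumr_ge0 => k _; exact: sqr_ge0.
- move=> n; have [_ [_ _ + _] _ _] := hp n; apply: le_trans.
  rewrite /energy le_eqVlt; apply/orP; left; apply/eqP/EFin_inj.
  have i : itg 0 T (fun s => \sum_(k < d) w n k s ^+ 2).
    have : leb.-integrable `[0%R, T]%classic (fun s => \sum_(k < d) (w n k s ^+ 2)%:E)%E.
      by apply: integrable_sum => // k _; exact: iw.
    by apply: eq_integrable => // s _; rewrite sumEFin.
  rewrite -(rint_EFin i) -sumEFin; under eq_integral do rewrite -sumEFin.
  rewrite integral_sum // => [|k]; last exact: iw.
  by apply: eq_bigr => k _; rewrite (rint_EFin (iw n k)).
- by apply: measurable_sum => k; exact: measurable_funX.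
- by move=> s; apply: sumr_ge0 => k _; exact: sqr_ge0.
- have := ae_forall_ord (fun k => let: And4 _ _ h _ := hv k in h).
  move/aeS; apply => s h sT; apply: cvg_sum_ord => k.
  by rewrite expr2; under eq_fun do rewrite expr2; apply: cvgM; exact: h.
Unshelve. all: by end_near. Qed.

End WeakClosure.

End L2Limits.

(** * The constrained path set is closed for uniform convergence, hence measurable *)

Section ClosedPathSpace.
Context {R : realType} {d N : nat} (e : 'I_N -> vec R d).
Hypothesis e_unit : forall i, enorm (e i) = 1.
Hypothesis e_inj : injective e.
Variables (T C : R).
Hypothesis T0 : 0 < T.
Implicit Types (x z : vec R d) (y : R -> vec R d) (i : 'I_N) (s : R).

Lemma closed_line i : closed [set z : vec R d | exists r : R, z = r *: e i].
Proof.
have -> : [set z : vec R d | exists r : R, z = r *: e i] = \bigcap_(k in [set: 'I_d])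
      ((fun x => x ord0 k - ip e x i * e i ord0 k) @^-1` [set 0]).
  apply/seteqP; split => x /=.
    by move=> [r ->] k _ /=; rewrite ip_scale // mxE subrr.
  move=> h; exists (ip e x i); apply: coords_scale => k.
  by apply/eqP; rewrite -subr_eq0; apply/eqP; exact: h.
apply: closed_bigI => k _; apply: closed_comp.
  move=> x _; apply: (@cvgB _ _ _ (nbhs x)); first exact: (@coord_cont R d k x).
  by apply: cvgM; [exact: ip_continuous|exact: cvg_cst].
by apply: accessible_closed_set1; apply: hausdorff_accessible; exact: norm_hausdorff.
Qed.

Lemma enorm_continuous : continuous (@enorm R d).
Proof.
move=> x; apply: (@continuous_comp _ _ _ (fun z : vec R d => \sum_(k < d) z ord0 k ^+ 2) Num.sqrt);
  last exact: sqrt_continuous.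
apply: (@cvg_sum_ord _ _ _ (nbhs x) _ (fun k (z : vec R d) => z ord0 k ^+ 2)) => k.
by rewrite expr2; under eq_fun do rewrite expr2; apply: cvgM; exact: (@coord_cont R d k x).
Qed.

Lemma closed_approx (A : set (vec R d)) x : closed A ->
  (forall r, 0 < r -> exists2 z, A z & cnear r z x) -> A x.
Proof.
move=> cA h; apply: contrapT => nA.
have /nbhs_ballP[r /= r0 rA] : nbhs x (~` A) by apply: open_nbhs_nbhs; split => //; exact: closed_openC.
have [z Az zx] := h _ r0.
by apply: (rA z) => //; exact: cnear_ball.
Qed.

Lemma enorm_sqr x : enorm x ^+ 2 = \sum_(k < d) x ord0 k ^+ 2.
Proof. by rewrite /enorm sqr_sqrtr // sumr_ge0 // => k _; exact: sqr_ge0. Qed.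

Lemma energyE (v : 'I_d -> R -> R) : (forall k, itg 0 T (fun s => v k s ^+ 2)) ->
  (\int[leb]_(s in `[0%R, T]) (\sum_(k < d) v k s ^+ 2)%:E)%E = (energy T v)%:E.
Proof.
move=> iv; under eq_integral do rewrite -sumEFin.
rewrite integral_sum // /energy -sumEFin.
by apply: eq_bigr => k _; rewrite (rint_EFin (iv k)).
Qed.

Lemma tGam_velocity x y : tGam e T C x y -> exists v : 'I_d -> R -> R,
  [/\ forall k, measurable_fun `[0, T] (v k), forall k, itg 0 T (fun s => v k s ^+ 2),
     energy T v <= C ^+ 2 &
     forall s, 0 <= s <= T -> forall k, rint 0 s (v k) = y s ord0 k - y 0 ord0 k].
Proof.
move=> [_ [_ [_ [_ [v [mv [hv [_ ev]]]]]]]].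
pose w : 'I_d -> R -> R := fun k s => v s ord0 k.
have ev' : (\int[leb]_(s in `[0%R, T]) (\sum_(k < d) w k s ^+ 2)%:E <= (C ^+ 2)%:E)%E.
  by under eq_integral do rewrite -enorm_sqr.
have mw k : measurable_fun `[0, T] (w k) by exact: mv.
have iw k : itg 0 T (fun s => w k s ^+ 2).
  have m1 : measurable_fun `[0%R, T]%classic (fun s => (w k s ^+ 2)%:E).
    by apply/measurable_EFinP; apply: measurable_funX; exact: mw.
  have m2 : measurable_fun `[0%R, T]%classic (fun s => (\sum_(j < d) w j s ^+ 2)%:E).
    by apply/measurable_EFinP; apply: measurable_sum => j; apply: measurable_funX; exact: mw.
  apply: sqr_itg => //; apply: le_lt_trans (le_lt_trans ev' (ltry _)).
  apply: (ge0_le_integral leb _ _ m1 m2) => //.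
  - by move=> s _; rewrite lee_fin sqr_ge0.
  - move=> s _; rewrite lee_fin (bigD1 k) //= lerDl.
    by apply: sumr_ge0 => j _; exact: sqr_ge0.
exists w; split => //; first by rewrite energyE // lee_fin in ev'.
move=> s sT k; apply: EFin_inj; rewrite (hv _ sT) rint_EFin //.
by apply: itgS (itg_of_sqr (mw k) (iw k)) => //; case/andP: sT.
Qed.

Lemma tGam_clamp x y s : tGam e T C x y -> y (clamp 0 T s) = y s.
Proof.
move=> [_ [y0 [yT _]]]; rewrite /clamp.
case: (leP 0 s) => s0; case: leP => sT //.
- by rewrite yT.
- by move: (lt_le_trans T0 sT); rewrite ltxx.
- by rewrite [RHS]y0 // ltW.
Qed.

Lemma tGam_net x y s : tGam e T C x y -> net e (y s).
Proof.
move=> Gy; rewrite -(tGam_clamp s Gy); case: Gy => _ [_ [_ [h _]]].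
by case: (h (clamp 0 T s)) => //; apply: clamp_in; exact: ltW.
Qed.

Lemma tGam_continuous x y : tGam e T C x y -> continuous y.
Proof.
move=> Gy; have [v [mv iv ev hv]] := tGam_velocity Gy.
have vle k : rint 0 T (fun s => v k s ^+ 2) <= C ^+ 2.
  apply: le_trans ev; rewrite /energy (bigD1 k) //= lerDl.
  by apply: sumr_ge0 => j _; exact: rint_sqr_ge0.
move=> s A /nbhs_ballP[eps /= eps0 epsA].
pose M1 := C ^+ 2 + 1; have M10 : 0 < M1 by rewrite ltr_wpDl // sqr_ge0.
have [lam l0 lamE] : exists2 lam : R, 0 < lam & lam * M1 = eps.
  by exists (eps / M1); rewrite ?divr_gt0 // mulfVK // gt_eqF.
have key u u' k : 0 <= u -> u <= u' -> u' <= T -> u' - u < eps * lam ->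
    `|y u' ord0 k - y u ord0 k| < eps.
  move=> u0 uu uT ud.
  have -> : y u' ord0 k - y u ord0 k = rint u u' (v k).
    have u'T : 0 <= u' <= T by rewrite uT (le_trans u0).
    have uT' : 0 <= u <= T by rewrite u0 (le_trans uu).
    have := hv _ u'T k; rewrite (@rint_split _ 0 u' u) ?u0 //.
      by rewrite hv // => E; rewrite -[y u' ord0 k](subrK (y 0 ord0 k)) -E; ring.
    by apply: itgS (itg_of_sqr (mv k) (iv k)).
  have ui : itg u u' (v k).
    by apply: itgS (itg_of_sqr (mv k) (iv k)).
  have vM : rint 0 T (fun s => v k s ^+ 2) <= M1 by rewrite (le_trans (vle k)) // lerDl.
  apply: le_lt_trans (rint_norm_le ui) _.
  apply: le_lt_trans (rint_abs_sqr_le (mv k) (iv k) vM l0 u0 uu uT) _.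
  have -> : lam / 2 * M1 = eps / 2 by rewrite -lamE mulrAC.
  rewrite [X in _ < X](splitr eps) ltrD2l ltr_pdivrMr ?mulr_gt0 //.
  by rewrite (_ : eps / 2 * (2 * lam) = eps * lam) //; field.
apply/nbhs_ballP; exists (eps * lam) => /=; first exact: mulr_gt0.
move=> s' ss; apply: epsA; apply: cnear_ball => // k.
rewrite -(tGam_clamp s' Gy) -(tGam_clamp s Gy).
have dd : `|clamp 0 T s' - clamp 0 T s| < eps * lam.
  by apply: le_lt_trans (clamp_lip _ _ _ _) _; rewrite distrC.
have /andP[a0 aT] := clamp_in s (ltW T0); have /andP[b0 bT] := clamp_in s' (ltW T0).
have [le|/ltW le] := leP (clamp 0 T s) (clamp 0 T s').
  by apply: key => //; rewrite -[X in X < _]ger0_norm // subr_ge0.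
by rewrite distrC; apply: key => //; rewrite -[X in X < _]ger0_norm ?subr_ge0 // distrC.
Qed.

Lemma limit_in_closed (A : set (vec R d)) (Q : 'I_d -> R -> R) z : closed A ->
  (forall k, Q k h @[h --> 0^'] --> z ord0 k) ->
  (forall del, 0 < del -> exists h, [/\ h != 0, `|h| < del &
     exists2 q : vec R d, A q & forall k, q ord0 k = Q k h]) -> A z.
Proof.
move=> cA cQ hQ; apply: closed_approx => // r r0.
have : \forall h \near 0^', forall k, `|z ord0 k - Q k h| < r.
  by apply: filter_forall => k; have /cvgrPdist_lt := cQ k; exact.
move=> /nbhs_ballP[del /= del0 near].
have [h [h0 hd [q Aq qE]]] := hQ _ del0.
exists q => // k; rewrite qE distrC; apply: near => //.
by rewrite /ball /= sub0r normrN.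
Qed.

(* At a point of differentiability the velocity is tangent: the network is a closed cone, so the
   limit of the difference quotients at the vertex lies on a ray. *)
Lemma velocity_tangent y (v : 'I_d -> R -> R) :
  (forall s, 0 <= s <= T -> net e (y s)) -> (forall k, itg 0 T (v k)) ->
  (forall s, 0 <= s <= T -> forall k, rint 0 s (v k) = y s ord0 k - y 0 ord0 k) ->
  {ae leb, forall s, 0 <= s <= T -> tF e (y s) (\row_k v k s)}.
Proof.
move=> yn iv hv.
(* Extended by zero, each component is integrable on the line, and almost every time is a point of
   differentiation of its primitive. *)
pose f k := v k \_ `[0, T]%classic.
have if_ k u : leb.-integrable `[0%R, u]%classic (EFin \o f k).
  have : leb.-integrable [set: R] (EFin \o f k).
    rewrite /f -restrict_EFin; apply/integrable_restrict => //.
    by rewrite setTI; exact: iv.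
  exact: integrableS.
have F1 k := FTC1 (a := BLeft 0) (if_ k) (integrable_locally (measurable_itv _) (iv k)).
apply: aeS (aeI (ae_forall_ord F1) (aeI (ae_neq 0) (ae_neq T))) _ => s [Fs [s0 sT]] /andP[s0' sT'].
have {s0 s0'} s0 : 0 < s by rewrite lt_neqAle eq_sym s0.
have {sT sT'} sT : s < T by rewrite lt_neqAle sT.
have sT0 : 0 <= s <= T by rewrite !ltW.
pose F k (x : R) : R := \int[leb]_(r in [set` Interval (BLeft 0) (BRight x)]) f k r.
have FE k (x : R) : 0 <= x <= T -> F k x = y x ord0 k - y 0 ord0 k.
  move=> /andP[x0 xT]; rewrite -hv ?x0 //; apply: eq_rint => r /andP[r0 rx].
  by rewrite /f patchE mem_set //= in_itv /= r0 (le_trans rx).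
have dF k : derivable (F k) s 1 /\ (F k)^`()%classic s = v k s.
  have s0' : (BLeft (0%R : R) < BRight s)%E by rewrite /= lte_fin.
  have [h1 h2] := Fs k s0'.
  by split => //; rewrite h2 /f patchE mem_set //= in_itv /=.
pose Q k h := h^-1 * (F k (h + s) - F k s).
have cQ k : Q k h @[h --> 0^'] --> (\row_j v j s) ord0 k.
  rewrite mxE; have [dFk] := dF k; rewrite derive1E => <-.
  have -> : Q k = fun h => h^-1 *: (F k (h *: 1 + s) - F k s).
    by apply/funext => h; rewrite [h *: 1]mulr1.
  exact: dFk.
have small del : 0 < del -> exists2 r, 0 < r < del & forall h, `|h| <= r -> 0 <= h + s <= T.
  move=> del0; exists (Num.min (del / 2) (Num.min s (T - s))).
    rewrite !lt_min divr_gt0 // s0 subr_gt0 sT /=.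
    by apply: (@le_lt_trans _ _ (del / 2)); [rewrite ge_min lexx|lra].
  move=> h; rewrite !le_min => /and3P[_ h1 h2].
  by move: h1 h2; rewrite !ler_norml => /andP[? ?] /andP[? ?]; apply/andP; split; lra.
have qE h : 0 <= h + s <= T -> forall k, (h^-1 *: (y (h + s) - y s)) ord0 k = Q k h.
  by move=> hs k; rewrite /Q !FE // !mxE; congr (_ * _); ring.
split.
  (* Off the vertex the path stays on the open ray i for a short time, so the difference quotients
     lie on the line of e_i, which is closed. *)
  move=> i yi.
  have cy k : {for s, continuous (F k)}.
    by apply: differentiable_continuous; apply/derivable1_diffP; case: (dF k).
  have [r r0 hr] := ray'_near e_unit e_inj yi.
  have /choice[dl dlP] : forall k, exists del, 0 < del /\ forall x : R, `|s - x| < del ->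
      `|F k s - F k x| < r.
    move=> k; have /cvgrPdist_lt /(_ _ r0) /nbhs_ballP[del /= del0 h] := cy k.
    by exists del; split => // x sx; exact: h.
  pose del := \big[Num.min/1]_(k < d) dl k.
  have del0 : 0 < del.
    by rewrite /del; elim/big_ind: _ => // [a b a0 b0|k _]; [rewrite lt_min a0|case: (dlP k)].
  have near (x : R) k : `|s - x| < del -> `|F k s - F k x| < r.
    by move=> sx; apply: (dlP k).2; apply: lt_le_trans sx _; exact: bigmin_le_cond.
  apply: (limit_in_closed (@closed_line i) cQ) => del' del'0.
  have dd0 : 0 < Num.min del del' by rewrite lt_min del0.
  have [h /andP[h0 hd] hs] := small _ dd0.
  exists h; rewrite gt_eqF // gtr0_norm //; split => //.
    by apply: lt_le_trans hd _; rewrite ge_min lexx orbT.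
  have hsT := hs h; rewrite gtr0_norm // in hsT.
  have {}hsT := hsT (lexx _).
  exists (h^-1 *: (y (h + s) - y s)); last exact: qE.
  have yhi : ray' e i (y (h + s)).
    apply: hr; first exact: yn.
    move=> k; have := near (h + s) k; rewrite opprD addrCA subrr addr0 normrN gtr0_norm //.
    rewrite !FE // distrC => hh.
    have -> : y (h + s) ord0 k - y s ord0 k =
       y (h + s) ord0 k - y 0 ord0 k - (y s ord0 k - y 0 ord0 k) by ring.
    by apply: hh; apply: lt_le_trans hd _; rewrite ge_min lexx.
  case: yhi => a _ ->; case: yi => b _ ->.
  by exists (h^-1 * (a - b)); rewrite -scalerBl scalerA.
move=> ys0.
have [i [r r0 ->]] : net e (\row_k v k s).
  apply: (limit_in_closed (closed_net e_unit) cQ) => del' del'0.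
  have [h /andP[h0 hd] hs] := small del' del'0.
  exists h; rewrite gt_eqF // gtr0_norm //; split => //.
  have hsT := hs h; rewrite gtr0_norm // in hsT.
  have {}hsT := hsT (lexx _).
  exists (h^-1 *: (y (h + s) - y s)); last exact: qE.
  rewrite ys0 subr0; have [i [a a0 ->]] := yn _ hsT.
  by exists i, (h^-1 * a); rewrite ?scalerA // mulr_ge0 // invr_ge0 ltW.
by exists i, r.
Qed.

(** The energy bound and the primitive come from [weak_closure]; tangency is not passed to the limit
    but derived by [velocity_tangent] from the limit path lying in the network. *)
Lemma tGamC_closed y :
  (forall eps, 0 < eps -> exists2 z, tGamC e T C z & forall s, ball (y s) eps (z s)) ->
  tGamC e T C y.
Proof.
move=> h.
have near eps : 0 < eps -> exists x (z : R -> vec R d), tGam e T C x z /\ forall s, cnear eps (z s) (y s).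
  move=> eps0; have [z [x Gz] zy] := h _ eps0.
  by exists x, z; split => // s; exact: ball_cnear.
(* An identity between the positions at two times survives uniform limits; it is used for the
   constancy outside [0, T]. *)
have eqy s s' : (forall x (z : R -> vec R d), tGam e T C x z -> z s = z s') -> y s = y s'.
  move=> zz; apply/rowP => k; apply/eqP; rewrite -subr_eq0 -normr_le0; apply/ler_addgt0Pr => eps eps0.
  have [|x [z [Gz zy]]] := near (eps / 2); first by rewrite divr_gt0.
  have := zy s k; have := zy s' k; rewrite (zz _ _ Gz) !ltr_norml add0r => /andP[? ?] /andP[? ?].
  by rewrite ler_norml; apply/andP; split; lra.
have yn s : 0 <= s <= T -> net e (y s) /\ enorm (y s) <= C.
  move=> sT; apply: (@closed_approx (net e `&` (@enorm R d) @^-1` [set c | c <= C])).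
    apply: closedI; first exact: closed_net.
    by apply: closed_comp; [move=> ? _; exact: enorm_continuous|exact: closed_le].
  move=> r r0; have [x [z [Gz zy]]] := near _ r0; exists (z s) => //.
  by case: Gz => _ [_ [_ [+ _]]] => /(_ _ sT)[zn]; rewrite gdist0.
have [v [mv iv hv ev]] : exists v : 'I_d -> R -> R,
    [/\ forall k, measurable_fun `[0, T] (v k), forall k, itg 0 T (v k),
       forall s, 0 <= s <= T -> forall k, rint 0 s (v k) = y s ord0 k - y 0 ord0 k &
       (\int[leb]_(s in `[0%R, T]) (\sum_(k < d) v k s ^+ 2)%:E <= (C ^+ 2)%:E)%E].
  apply: (weak_closure (D := fun k s => y s ord0 k - y 0 ord0 k) (ltW T0)) => eta eta0.
  have [|x [z [Gz zy]]] := near (eta / 2); first by rewrite divr_gt0.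
  have [w [mw iw ew hw]] := tGam_velocity Gz.
  exists w; split => // s sT k; rewrite (hw _ sT).
  have := zy s k; have := zy 0 k; rewrite !ltr_norml => /andP[? ?] /andP[? ?].
  by rewrite ler_norml; apply/andP; split; lra.
exists (y 0); split => //; split.
  by move=> s s0; apply: eqy => x z [_ [+ _]]; exact.
split.
  by move=> s s0; apply: eqy => x z [_ [_ [+ _]]]; exact.
split.
  by move=> s /yn[? ?]; rewrite gdist0.
exists (fun s => \row_k v k s); split.
  by move=> k; apply: eq_measurable_fun (mv k) => s _; rewrite mxE.
split.
  move=> s sT k; rewrite -(hv _ sT) -rint_EFin.
    by apply: eq_integral => r _; rewrite mxE.
  by apply: itgS (iv k) => //; case/andP: sT.
split.
  have := velocity_tangent (fun s sT => (yn s sT).1) iv hv.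
  by move/aeS; apply => s hs; rewrite /= in_itv.
apply: le_trans ev; rewrite le_eqVlt; apply/orP; left; apply/eqP.
by apply: eq_integral => s _; rewrite enorm_sqr; under eq_bigr do rewrite mxE.
Qed.

(* The hypothesis mu (tGamC e T C) = 1 carries no information unless this set is measurable. *)
Lemma measurable_tGamC : measurable (tGamC e T C).
Proof.
rewrite -[tGamC e T C]setCK; apply: measurableC; apply: sub_sigma_algebra => y ny.
apply: contrapT => nex; apply: ny; apply: tGamC_closed => eps eps0.
apply: contrapT => nz; apply: nex; exists eps => // z zy Gz; apply: nz.
by exists z.
Qed.

End ClosedPathSpace.

Section FlowContinuity.
Context {R : realType} {d N : nat} (e : 'I_N -> vec R d).
Hypothesis e_unit : forall i, enorm (e i) = 1.
Hypothesis e_inj : injective e.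
Variables (T C : R) (mu : probability (PathM R d) R).
Hypothesis T0 : 0 < T.
Hypothesis mu1 : mu (tGamC e T C) = 1%E.
Implicit Types (s t : R) (f : vec R d -> R).

Lemma measurable_closed_TG (A : set (vec R d)) : closed A -> measurable (A : set (TG R d)).
Proof.
move=> cA; rewrite -[A]setCK; apply: measurableC; apply: sub_sigma_algebra.
exact: closed_openC.
Qed.

Lemma measurable_net : measurable (net e : set (TG R d)).
Proof. by apply: measurable_closed_TG; exact: closed_net. Qed.

Let mG : measurable (tGamC e T C).
Proof. exact: measurable_tGamC. Qed.

Lemma measurable_evt_net t : measurable (@evt R d t @^-1` net e).
Proof. by rewrite -[X in measurable X]setTI; apply: measurable_evt => //; exact: measurable_net. Qed.

Lemma tGamC_evt t : tGamC e T C `<=` @evt R d t @^-1` net e.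
Proof. by move=> y [x Gy]; exact: (tGam_net T0 t Gy). Qed.

Lemma PG_mflow t : PG e (mflow mu t).
Proof.
apply/le_anti/andP; split; first exact: probability_le1 measurable_net.
rewrite -mu1; apply: le_measure; rewrite ?inE //; first exact: measurable_evt_net.
exact: tGamC_evt.
Qed.

(** The function is continuous only on the network. After extension by zero, the preimage of a
    half-line is a relatively open set of the closed network, joined by the complement of the
    network exactly when c < 0. *)
Lemma measurable_restrict_net f : {within net e, continuous f} ->
  measurable_fun setT (f \_ (net e) : TG R d -> R).
Proof.
move=> cf; apply: (measurability (@RGenOInfty.G R)); first exact: RGenOInfty.measurableE.
move=> _ [_ [c ->] <-]; rewrite setTI.
have [V oV VE] : exists2 V : set (vec R d), open V &
    V `&` net e = f @^-1` `]c, +oo[%classic `&` net e.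
  apply/open_subspaceP; move/continuousP: cf; apply; exact: interval_open.
have -> : (f \_ (net e)) @^-1` `]c, +oo[%classic =
   (V `&` net e) `|` (if c < 0 then ~` (net e) else set0).
  rewrite VE; apply/seteqP; split => x.
    rewrite /= patchE; case: ifPn => [/set_mem xn fx|/negP xn]; first by left; split.
    rewrite in_itv /= andbT => fx; right; have c0 : c < 0 by exact: fx.
    by rewrite c0 => xn'; apply: xn; exact: mem_set.
  move=> [[fx xn]|]; first by rewrite /= patchE mem_set.
  by case: ifPn => // c0 xn; rewrite /= patchE memNset // in_itv /= andbT.
apply: measurableU.
  by apply: measurableI; [exact: sub_sigma_algebra|exact: measurable_net].
by case: ifP => // _; apply: measurableC; exact: measurable_net.
Qed.

(** Moves the integral to the path space and drops the null set of paths outside [tGamC], so that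
    only continuous paths remain. *)
Lemma integG_mflow f t : bcontG e f ->
  integG e (mflow mu t) f = \int[mu]_(y in tGamC e T C) ((f \_ (net e)) (y t)).
Proof.
move=> [cf [M fM]]; have mf := measurable_restrict_net cf.
have mfe : measurable_fun setT (fun y : PathM R d => (f \_ (net e)) (@evt R d t y)).
  by apply: measurableT_comp => //; exact: measurable_evt.
have bnd x : `|(f \_ (net e)) x| <= `|M|.
  rewrite patchE; case: ifPn => [/set_mem /fM h|_]; last by rewrite normr0.
  by rewrite (le_trans h) // ler_norm.
have ife : mu.-integrable setT (EFin \o (fun y : PathM R d => (f \_ (net e)) (@evt R d t y))).
  apply: measurable_bounded_integrable => //; first by rewrite (le_lt_trans (probability_le1 _ _)) ?ltry.
  exists `|M|; split; first exact: num_real.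
  by move=> c Mc y _; exact: le_trans (bnd _) (ltW Mc).
rewrite /integG /Rintegral; congr fine.
transitivity (\int[mflow mu t]_(x in net e) ((f \_ (net e)) x)%:E)%E.
  by apply: eq_integral => x xn; rewrite patchE xn.
rewrite /mflow /distribution integral_pushforward //; last 3 first.
- exact/measurable_EFinP.
- by apply: integrableS ife => //; exact: measurable_evt_net.
- exact: measurable_net.
have mN : measurable ((@evt R d t @^-1` net e) `\` tGamC e T C).
  by apply: measurableD => //; exact: measurable_evt_net.
rewrite (negligible_integral mN) //; last 3 first.
- exact: measurable_evt_net.
- by apply: integrableS ife => //; exact: measurable_evt_net.
- apply/le_anti/andP; split; last exact: measure_ge0.
  have <- : mu (~` tGamC e T C) = 0%E.
    by rewrite probability_setC // mu1 subee.
  by apply: le_measure; rewrite ?inE; [exact: mN|exact: measurableC|move=> y []].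
by rewrite setDD (setIidr (@tGamC_evt t)).
Qed.

Lemma integG_continuous f : bcontG e f -> continuous (fun t => integG e (mflow mu t) f).
Proof.
move=> bf; have [cf [M fM]] := bf; have mf := measurable_restrict_net cf.
have -> : (fun t => integG e (mflow mu t) f) =
    (fun t => \int[mu]_(y in tGamC e T C) ((f \_ (net e)) (y t))).
  by apply/funext => t; exact: integG_mflow.
have bnd x : `|(f \_ (net e)) x| <= `|M|.
  rewrite patchE; case: ifPn => [/set_mem /fM h|_]; last by rewrite normr0.
  by rewrite (le_trans h) // ler_norm.
move=> t.
(* Paths in [tGamC] are constant outside [0, T], so any window around t will do, even one that
   leaves [0, T]. *)
have tin : t \in `]t - 1, t + 1[%classic by rewrite inE /= in_itv /=; lra.
apply: (@continuity_under_integral R _ (PathM R d) mu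
   (fun t y => (f \_ (net e)) (y t)) (tGamC e T C) mG (t - 1) (t + 1) _ _ (fun=> `|M|)) => //.
- move=> s _; apply: measurable_bounded_integrable => //.
  + exact: le_lt_trans (probability_le1 mu mG) (ltry 1).
  + have mfe : measurable_fun setT (fun y : PathM R d => (f \_ (net e)) (@evt R d s y)).
      by apply: measurableT_comp => //; exact: measurable_evt.
    exact: measurable_funS mfe.
  + exists `|M|; split; first exact: num_real.
    by move=> c Mc y _; exact: le_trans (bnd _) (ltW Mc).
- apply: aeW => y [x Gy] s _; have cy := tGam_continuous T0 Gy.
  have -> : (fun s => (f \_ (net e)) (y s)) = (fun s => f (y s)).
    by apply/funext => r; rewrite patchE mem_set //; exact: (tGam_net T0 r Gy).
  have ys := tGam_net T0 s Gy.
  move/subspace_continuousP: cf => /(_ _ ys) cf.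
  move=> A /cf nA.
  have {}nA : nbhs (y s) [set x | net e x -> A (f x)] by exact: nA.
  have /nbhs_ballP[r r0 h] := cy s _ nA; apply/nbhs_ballP; exists r => // s' ss.
  by apply: h ss _; exact: (tGam_net T0 s' Gy).
- exact: finite_measure_integrable_cst.
- by move=> s _; apply: aeW => y _; exact: bnd.
Qed.

(** A basic narrow neighbourhood tests finitely many functions, so the least of their time
    tolerances works, uniformly in y. *)
Lemma narrow_cont_mflow {Y : Type} (S : set Y) (Phi : probability (TG R d) R -> Y -> R) t eps :
  narrow_cont e S Phi -> 0 < eps ->
  exists2 del, 0 < del & forall s, `|s - t| < del -> forall y, S y ->
    `|Phi (mflow mu s) y - Phi (mflow mu t) y| <= eps.
Proof.
move=> nc eps0; have [n [fs [delta [delta0 [bfs h]]]]] := nc _ (PG_mflow t) _ eps0.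
have /choice[dl dlP] : forall k, exists del, 0 < del /\ forall s, `|s - t| < del ->
    `|integG e (mflow mu s) (fs k) - integG e (mflow mu t) (fs k)| < delta.
  move=> k; have ct : continuous _ := integG_continuous (bfs k).
  have /cvgrPdist_lt /(_ _ delta0) /nbhs_ballP[del /= del0 hd] := ct t.
  exists del; split => // s st; rewrite distrC; apply: hd.
  by rewrite /ball /= distrC.
pose del := \big[Num.min/1]_(k < n) dl k.
have del0 : 0 < del.
  by rewrite /del; elim/big_ind: _ => // [a b a0 b0|k _]; [rewrite lt_min a0|case: (dlP k)].
exists del => // s st y Sy; apply: h => //; first exact: PG_mflow.
by move=> k; apply: (dlP k).2; apply: lt_le_trans st _; exact: bigmin_le_cond.
Qed.

(** The measure is changed first, with an error uniform in (z, s) by the sup norm in [narrow_cont];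
    then (z, s) moves under the fixed measure at time t. *)
Lemma running_cost_continuous (L : probability (TG R d) R -> vec R d -> R -> R) :
  (forall m, PG e m -> {within net e `*` `[0%R, T]%classic, continuous (fun p => L m p.1 p.2)}) ->
  narrow_cont e (net e `*` `[0%R, T]%classic) (fun m p => L m p.1 p.2) ->
  {within net e `*` `[0%R, T]%classic, continuous (fun p => L (mflow mu p.2) p.1 p.2)}.
Proof.
move=> cL nL; apply/subspace_continuousP => -[x t] [/= xn tT].
have tT' : 0 <= t <= T by move: tT; rewrite in_itv.
apply/cvgrPdist_lt => eps eps0; have e2 : 0 < eps / 2 by rewrite divr_gt0.
have [del del0 hd] := narrow_cont_mflow t nL e2.
have [r r0 hr] := within_net_eps (cL _ (PG_mflow t)) xn tT' e2.
rewrite /within /=; apply/nbhs_ballP; exists (Num.min del r) => /=; first by rewrite lt_min del0.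
move=> [z s] [/= [_ zx] st] [/= zn sT].
have st' : `|s - t| < Num.min del r by move: st; rewrite /ball /= distrC.
have {}st : `|s - t| < del by rewrite (lt_le_trans st') // ge_min lexx.
have {}st' : `|s - t| < r by rewrite (lt_le_trans st') // ge_min lexx orbT.
have h1 := hd s st (z, s) (conj zn sT).
have h2 : `|L (mflow mu t) z s - L (mflow mu t) x t| < eps / 2.
  apply: hr => // k.
  have := zx ord0 k; rewrite /ball /= distrC => /lt_le_trans; apply.
  by rewrite ge_min lexx orbT.
suff : `|L (mflow mu t) x t - L (mflow mu s) z s| < eps by [].
rewrite distrC -(subrKA (L (mflow mu t) z s)) (le_lt_trans (ler_normD _ _)) //.
by rewrite [X in _ < X](splitr eps); move: h1 h2 => /=; lra.
Qed.

Lemma vertex_cost_continuous (Ls : probability (TG R d) R -> R -> R) :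
  (forall m, PG e m -> {within `[0%R, T]%classic, continuous (Ls m)}) ->
  narrow_cont e `[0%R, T]%classic Ls ->
  {within `[0%R, T]%classic, continuous (fun t => Ls (mflow mu t) t)}.
Proof.
move=> cL nL; apply/subspace_continuousP => t /= tT.
have tT' : 0 <= t <= T by move: tT; rewrite in_itv.
apply/cvgrPdist_lt => eps eps0; have e2 : 0 < eps / 2 by rewrite divr_gt0.
have [del del0 hd] := narrow_cont_mflow t nL e2.
have [r r0 hr] := within_itv_eps (cL _ (PG_mflow t)) tT' e2.
rewrite /within /=; apply/nbhs_ballP; exists (Num.min del r) => /=; first by rewrite lt_min del0.
move=> s; rewrite /ball /= distrC => st' sT.
have {}st : `|s - t| < del by rewrite (lt_le_trans st') // ge_min lexx.
have {}st' : `|s - t| < r by rewrite (lt_le_trans st') // ge_min lexx orbT.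
have h1 := hd s st s sT.
have h2 : `|Ls (mflow mu t) s - Ls (mflow mu t) t| < eps / 2.
  by apply: hr => //; move: sT; rewrite in_itv.
suff : `|Ls (mflow mu t) t - Ls (mflow mu s) s| < eps by [].
rewrite distrC -(subrKA (Ls (mflow mu t) s)) (le_lt_trans (ler_normD _ _)) //.
by rewrite [X in _ < X](splitr eps); move: h1 h2 => /=; lra.
Qed.

End FlowContinuity.

Unset Implicit Arguments.

Theorem mainTheorem15 (R : realType) (d N : nat) (e : 'I_N -> vec R d) (T : R)
  (L : 'I_N -> probability (TG R d) R -> vec R d -> R -> R)
  (Ls : probability (TG R d) R -> R -> R)
  (Gi : 'I_N -> probability (TG R d) R -> vec R d -> R)
  (Gs : probability (TG R d) R -> R)
  (m0 : probability (TG R d) R) (Ct C : R) (mu : probability (PathM R d) R) :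
  (* the network *)
  (2 <= N)%N -> (1 <= d)%N ->
  (forall i, enorm (e i) = 1) -> injective e -> 0 < T ->
  (* the MFG costs: values in C(G x [0,T]), C([0,T]), C(G), R ... *)
  (forall i m, PG e m ->
     {within net e `*` `[0%R, T]%classic, continuous (fun p => L i m p.1 p.2)}) ->
  (forall m, PG e m -> {within `[0%R, T]%classic, continuous (Ls m)}) ->
  (forall i m, PG e m -> {within net e, continuous (Gi i m)}) ->
  (* ... and continuous w.r.t. the narrow topology on P(G) and sup norms *)
  (forall i, narrow_cont e (net e `*` `[0%R, T]%classic) (fun m p => L i m p.1 p.2)) ->
  narrow_cont e `[0%R, T]%classic Ls ->
  (forall i, narrow_cont e (net e) (Gi i)) ->
  narrow_cont e [set: unit] (fun m (_ : unit) => Gs m) ->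
  (* (H^MFG_1) *)
  (exists K : R, forall m, PG e m ->
     (forall t, 0 <= t <= T -> `|Ls m t| <= K) /\
     (forall i x t, net e x -> 0 <= t <= T -> `|L i m x t| <= K) /\
     `|Gs m| <= K /\
     (forall i x, net e x -> `|Gi i m x| <= K)) ->
  (* (H^MFG_2) *)
  PG e m0 -> compact (msupp (@open (vec R d)) m0) ->
  (* the constant C~ *)
  0 < Ct ->
  (forall C' : R, 0 < C' -> forall mu' : probability (PathM R d) R,
     mu' (tGamC e T C') = 1%E ->
     forall x, msupp (@open (vec R d)) m0 x ->
     forall y a, Gam e T 0 x y a ->
       cost (Lmu e L Ls mu') (gmu e Gi Gs T mu') T 0 y a
         = infcost e (Lmu e L Ls mu') (gmu e Gi Gs T mu') T 0 x ->
       (\int[leb]_(s in `[0%R, T]%classic) (((a s).2) ^+ 2)%:E <= (Ct ^+ 2)%:E)%E /\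
       tGam e T Ct x (clampP T y)) ->
  Ct <= C ->
  (* mu is a constrained MFG equilibrium in P_{m0}(Gamma~_C) *)
  mu (tGamC e T C) = 1%E ->
  (forall A, measurable A -> mflow mu 0 A = m0 A) ->
  (forall y, msupp unif_open mu y ->
     exists x, msupp (@open (vec R d)) m0 x /\
       tGamOpt e (Lmu e L Ls mu) (gmu e Gi Gs T mu) T C x y) ->
  (* conclusion: u is a viscosity solution *)
  let u := valfun e (Lmu e L Ls mu) (gmu e Gi Gs T mu) T in
  let g := gmu e Gi Gs T mu in
  let l := fun i x t => L i (mflow mu t) x t in
  let lO := fun t => \big[Num.min/Ls (mflow mu t) t]_(i < N) l i 0 t in
  (forall x, net e x -> u x T = g x) /\
  (forall x t, net e x -> 0 < t < T ->
   forall (phi : vec R d -> R -> R) (Dx : 'I_N -> R -> R -> R) (Dt : vec R d -> R -> R),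
     C1net e T phi Dx Dt ->
     (locmax e T (fun z s => u z s - phi z s) x t ->
        (forall i, ray' e i x -> - Dt x t + Hi (l i x t) (Dx i (enorm x) t) <= 0) /\
        (x = 0 -> - Dt 0 t + HO (lO t) (fun i => l i 0 t) (fun i => Dx i 0 t) <= 0)) /\
     (locmin e T (fun z s => u z s - phi z s) x t ->
        (forall i, ray' e i x -> 0 <= - Dt x t + Hi (l i x t) (Dx i (enorm x) t)) /\
        (x = 0 -> 0 <= - Dt 0 t + HO (lO t) (fun i => l i 0 t) (fun i => Dx i 0 t)))).
Proof.
move=> N2 _ e_unit e_inj T0 cL cLs _ nL nLs _ _ [K hK] _ _ _ _ _ mu1 _ _ u g l lO.
have pg t : PG e (mflow mu t) by exact: (PG_mflow e_unit e_inj T0 mu1).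
have lc i : {within net e `*` `[0%R, T]%classic, continuous (fun p => l i p.1 p.2)}.
  apply: (running_cost_continuous e_unit e_inj T0 mu1 (L := L i)); last exact: nL.
  by move=> m pm; exact: cL.
have lsc : {within `[0%R, T]%classic, continuous (fun t => Ls (mflow mu t) t)}.
  by apply: (vertex_cost_continuous e_unit e_inj T0 mu1 (Ls := Ls)).
have lK i x t : net e x -> 0 <= t <= T -> `|l i x t| <= K.
  by move=> xn tT; case: (hK _ (pg t)) => _ [h _]; exact: h.
have lsK t : 0 <= t <= T -> `|Ls (mflow mu t) t| <= K.
  by move=> tT; case: (hK _ (pg t)) => h _; exact: h.
have gK x : net e x -> `|g x| <= K.
  move=> xn; have [_ [_ [h1 h2]]] := hK _ (pg T).
  (* [netG] is [netL] for costs that do not depend on time, so the bound at time 0 is the bound for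
     [g]. *)
  have := @netL_bound _ _ _ e e_unit e_inj T (fun i x _ => Gi i (mflow mu T) x)
    (fun=> Gs (mflow mu T)) K (fun i x t xn _ => h2 i x xn) (fun t _ => h1) x 0 xn.
  by apply; rewrite lexx ltW.
have N0 : (0 < N)%N by exact: ltnW.
split; first by move=> x _; rewrite /u /valfun ltxx.
move=> x t xn tT phi Dx Dt C1.
have lOE : lO t = netL e l (fun t => Ls (mflow mu t) t) 0 t by rewrite netL0.
split => hm; split.
- move=> i xi; exact: (sub_ray e_unit e_inj lc lsc lK lsK gK C1 xi tT hm).
- move=> x0; rewrite x0 in hm; rewrite lOE.
  exact: (sub_vertex e_unit e_inj lc lsc lK lsK gK C1 N0 tT hm).
- move=> i xi; exact: (super_ray e_unit e_inj lc lsc lK lsK gK C1 xi tT hm).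
- move=> x0; rewrite x0 in hm; rewrite lOE.
  exact: (super_vertex e_unit e_inj lc lsc lK lsK gK C1 N0 tT hm).
Qed.
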